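(* Let $1\leq p<\infty$, $p\neq 2$. Then $H^p$ contains no proper 1-complemented subspace of finite codimension.
   Context: All spaces are complex. $\mathbb{T}$ is the unit circle with normalized Lebesgue measure, and $H^p=H^p(\mathbb{T})$ is the closed subspace of $f\in L^p(\mathbb{T})$ whose Fourier coefficients with negative index vanish. A projection on a Banach space $X$ is a nonzero linear operator $P:X\to X$ with $P^2=P$; it is contractive if $\|P\|=1$. A closed subspace is 1-complemented if it is the range of a contractive projection. *)

(* Defs.v *)
From HB Require Import structures.
From mathcomp Require Import all_boot all_order all_algebra.
From mathcomp Require Import generic_quotient complex.
From mathcomp Require Import all_classical all_reals all_analysis.
From mathcomp Require Import measurable_realfun.

Set Implicit Arguments.
Unset Strict Implicit.
Unset Printing Implicit Defensive.
Import Order.TTheory GRing.Theory Num.Theory.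
Import ComplexField.Normc.
Import numFieldNormedType.Exports.

Local Open Scope classical_set_scope.
Local Open Scope ring_scope.
Local Open Scope complex_scope.

(* Complex L^p spaces, 1 <= p < oo, over an arbitrary measure space: the      *)
(* library only has the real-valued ones, without their normed structure.     *)

Section complex_integration.
Context d (T : measurableType d) (R : realType).
Variable mu : {measure set T -> \bar R}.

Definition cmeasurable (f : T -> R[i]) :=
  measurable_fun setT (fun x => complex.Re (f x)) /\
  measurable_fun setT (fun x => complex.Im (f x)).

Definition cintegral (f : T -> R[i]) : R[i] :=
  (\int[mu]_x complex.Re (f x)) +i* (\int[mu]_x complex.Im (f x)).

Definition cLnorm (p : R) (f : T -> R[i]) : \bar R :=
  Lnorm mu p%:E (fun x => (normc (f x))%:E).

Definition cLfun (p : R) : {pred T -> R[i]} :=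
  [pred f | `[< cmeasurable f /\ (cLnorm p f < +oo)%E >]].

End complex_integration.

Section complex_facts.
Context {R : realType}.

Lemma normcE (z : R[i]) : (normc z)%:C = `|z|. Proof. by []. Qed.

Lemma normc_ge0 (z : R[i]) : 0 <= normc z.
Proof. by rewrite -ler0c normcE. Qed.

Lemma ler_normcD (x y : R[i]) : normc (x + y) <= normc x + normc y.
Proof. by rewrite -lecR rmorphD /= !normcE ler_normD. Qed.

Lemma cReD (x y : R[i]) : complex.Re (x + y) = complex.Re x + complex.Re y.
Proof. by case: x y => [a b] [c e]. Qed.

Lemma cImD (x y : R[i]) : complex.Im (x + y) = complex.Im x + complex.Im y.
Proof. by case: x y => [a b] [c e]. Qed.

Lemma cReM (x y : R[i]) : complex.Re (x * y) =
  complex.Re x * complex.Re y - complex.Im x * complex.Im y.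
Proof. by case: x y => [a b] [c e]. Qed.

Lemma cImM (x y : R[i]) : complex.Im (x * y) =
  complex.Re x * complex.Im y + complex.Im x * complex.Re y.
Proof. by case: x y => [a b] [c e]. Qed.

Lemma ler_Re_normc (z : R[i]) : `|complex.Re z| <= normc z.
Proof.
case: z => a b /=; rewrite -sqrtr_sqr ler_wsqrtr// lerDl; exact: sqr_ge0.
Qed.

Lemma ler_Im_normc (z : R[i]) : `|complex.Im z| <= normc z.
Proof.
case: z => a b /=; rewrite -sqrtr_sqr ler_wsqrtr// lerDr; exact: sqr_ge0.
Qed.

End complex_facts.

Section cLfun_theory.
Context d (T : measurableType d) (R : realType).
Variable mu : {measure set T -> \bar R}.
Implicit Types f g : T -> R[i].

Lemma cmeasurable_normc f :
  cmeasurable f -> measurable_fun setT (fun x => normc (f x)).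
Proof.
move=> [mr mi].
have -> : (fun x => normc (f x)) =
    (fun x => Num.sqrt (complex.Re (f x) ^+ 2 + complex.Im (f x) ^+ 2)).
  by apply/funext => x; case: (f x).
apply: (@measurableT_comp _ _ _ _ _ _ (@Num.sqrt R)).
  apply: continuous_measurable_fun; exact: sqrt_continuous.
by apply: measurable_funD; exact: measurable_funX.
Qed.

Lemma measurable_abse_poweR (p : R) (g : T -> R) : measurable_fun setT g ->
  measurable_fun setT (fun x => `|(g x)%:E| `^ p)%E.
Proof.
move=> mg; apply: (@measurableT_comp _ _ _ _ _ _ (fun x => x `^ p)%E) => //.
  exact: measurable_poweR.
by apply: measurableT_comp => //; exact/measurable_EFinP.
Qed.

Lemma cmeasurable0 : cmeasurable (0 : T -> R[i]).
Proof. by split; exact: measurable_cst. Qed.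

Lemma cmeasurableD f g : cmeasurable f -> cmeasurable g -> cmeasurable (f + g).
Proof.
move=> [mf1 mf2] [mg1 mg2]; split.
- by under eq_fun do rewrite cReD; exact: measurable_funD.
- by under eq_fun do rewrite cImD; exact: measurable_funD.
Qed.

Lemma cmeasurableM f g :
  cmeasurable f -> cmeasurable g -> cmeasurable (fun x => f x * g x).
Proof.
move=> [mf1 mf2] [mg1 mg2]; split.
- by under eq_fun do rewrite cReM; apply: measurable_funB; exact: measurable_funM.
- by under eq_fun do rewrite cImM; apply: measurable_funD; exact: measurable_funM.
Qed.

Lemma cmeasurableZ (a : R[i]) f : cmeasurable f -> cmeasurable (a *: f).
Proof.
move=> mf; apply: (cmeasurableM (f := fun=> a)) mf.
by split; exact: measurable_cst.
Qed.

Lemma cLnorm0 (p : R) : p != 0 -> cLnorm mu p 0 = 0%E.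
Proof.
move=> p0; rewrite /cLnorm.
under (@eq_Lnorm _ _ _ mu) => x do rewrite normc0.
by apply: Lnorm0; rewrite eqe.
Qed.

Lemma cLnorm_poweR (p : R) f : p != 0 ->
  (cLnorm mu p f `^ p = \int[mu]_x ((normc (f x)) `^ p)%:E)%E.
Proof.
move=> p0; rewrite poweR_Lnorm//; apply: eq_integral => x _.
by rewrite gee0_abs ?lee_fin ?normc_ge0.
Qed.

Lemma cLnormZ (p : R) (a : R[i]) f : 0 < p -> cmeasurable f ->
  cLnorm mu p (a *: f) = ((normc a)%:E * cLnorm mu p f)%E.
Proof.
move=> p0 mf; rewrite /cLnorm unlock.
have E x : (`|(normc ((a *: f) x))%:E| `^ p =
    ((normc a) `^ p)%:E * `|(normc (f x))%:E| `^ p)%E.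
  rewrite normcM !gee0_abs ?lee_fin ?mulr_ge0 ?normc_ge0// EFinM.
  by rewrite poweRM ?lee_fin ?normc_ge0.
under eq_integral do rewrite E.
rewrite ge0_integralZl_EFin ?powR_ge0//; last first.
- exact/measurable_abse_poweR/cmeasurable_normc.
- by move=> x _; exact: poweR_ge0.
rewrite poweRM ?lee_fin ?powR_ge0//; last first.
  by apply: integral_ge0 => x _; exact: poweR_ge0.
by rewrite poweR_EFin -powRrM divff ?gt_eqF// powRr1 ?normc_ge0.
Qed.

Lemma cLnorm_le (p : R) (f : T -> R[i]) (g : T -> R) : 0 < p ->
  cmeasurable f -> measurable_fun setT g ->
  (forall x, normc (f x) <= g x) -> (cLnorm mu p f <= Lnorm mu p%:E (EFin \o g))%E.
Proof.
move=> p0 mf mg fg; rewrite /cLnorm unlock.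
apply: gt0_ler_poweR.
- by rewrite invr_ge0 ltW.
- rewrite in_itv/= leey andbT; apply: integral_ge0 => x _; by rewrite /= lee_fin powR_ge0.
- rewrite in_itv/= leey andbT; apply: integral_ge0 => x _; by rewrite /= lee_fin powR_ge0.
apply: ge0_le_integral => //.
- by move=> x _; exact: poweR_ge0.
- exact/measurable_abse_poweR/cmeasurable_normc.
- exact: measurable_abse_poweR.
move=> x _; have g0 : 0 <= g x := le_trans (normc_ge0 _) (fg x).
rewrite /= !ger0_norm ?normc_ge0// lee_fin.
by apply: ge0_ler_powR; rewrite ?nnegrE ?normc_ge0 ?fg ?g0 ?(ltW p0).
Qed.

Lemma cLnormD (p : R) f g : 1 <= p -> cmeasurable f -> cmeasurable g ->
  (cLnorm mu p (f + g)%R <= cLnorm mu p f + cLnorm mu p g)%E.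
Proof.
move=> p1 mf mg; have p0 : 0 < p := lt_le_trans ltr01 p1.
have m1 := cmeasurable_normc mf; have m2 := cmeasurable_normc mg.
apply: le_trans (minkowski_EFin mu m1 m2 p1).
apply: (cLnorm_le p0 (cmeasurableD mf mg)); first exact: measurable_funD.
by move=> x; exact: ler_normcD.
Qed.

Lemma cLnorm_ae_eq (p : R) f g : cmeasurable f -> cmeasurable g ->
  f = g %[ae mu] -> cLnorm mu p f = cLnorm mu p g.
Proof.
move=> mf mg fg; rewrite /cLnorm unlock; congr (_ `^ _)%E.
have mh (h : T -> R[i]) : cmeasurable h ->
    measurable_fun setT (fun x => `|(normc (h x))%:E| `^ p)%E.
  by move=> mh; exact/measurable_abse_poweR/cmeasurable_normc.
apply: ae_eq_integral => //; [exact: mh|exact: mh|].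
by apply: (ae_eq_comp (fun z : R[i] => `|(normc z)%:E| `^ p)%E).
Qed.

Lemma cLnorm_eq0 (p : R) f : 0 < p -> cmeasurable f ->
  cLnorm mu p f = 0%E -> f = 0 %[ae mu].
Proof.
move=> p0 mf /Lnorm_eq0_eq0; rewrite lte_fin => /(_ _ p0).
have mn := (measurable_EFinP _ _).2 (cmeasurable_normc mf).
move=> /(_ mn); apply: filterS => x /(_ I) [] /eq0_normc fx _.
exact: fx.
Qed.

Lemma cLfunP (p : R) f :
  f \in cLfun mu p <-> cmeasurable f /\ (cLnorm mu p f < +oo)%E.
Proof. by split => [/asboolP|?] //; apply/asboolP. Qed.

Lemma cLfun_submod_closed (p : R) : 1 <= p -> submod_closed (cLfun mu p).
Proof.
move=> p1; have p0 : 0 < p := lt_le_trans ltr01 p1; split.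
  by apply/cLfunP; split; [exact: cmeasurable0|rewrite cLnorm0 ?gt_eqF].
move=> a f g /cLfunP[mf ff] /cLfunP[mg fg]; apply/cLfunP; split.
  exact/cmeasurableD/mg/cmeasurableZ.
apply: le_lt_trans (cLnormD p1 (cmeasurableZ a mf) mg) _.
rewrite lte_add_pinfty// cLnormZ// lte_mul_pinfty//.
by rewrite lee_fin normc_ge0.
Qed.

End cLfun_theory.

Section cintegral_theory.
Context d (T : measurableType d) (R : realType).
Variable mu : {measure set T -> \bar R}.
Implicit Types f g : T -> R[i].

Definition cintegrable f :=
  mu.-integrable setT (EFin \o (fun x => complex.Re (f x))) /\
  mu.-integrable setT (EFin \o (fun x => complex.Im (f x))).

Lemma cintegralD f g : cintegrable f -> cintegrable g ->
  cintegral mu (f + g) = cintegral mu f + cintegral mu g.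
Proof.
move=> [f1 f2] [g1 g2]; rewrite /cintegral.
under eq_Rintegral do rewrite cReD.
under [X in _ +i* X]eq_Rintegral do rewrite cImD.
by rewrite !RintegralD.
Qed.

Lemma cintegralZ (a : R[i]) f : cintegrable f ->
  cintegral mu (a *: f) = a * cintegral mu f.
Proof.
case: a => a b [f1 f2]; rewrite /cintegral.
under eq_Rintegral do rewrite cReM /=.
under [X in _ +i* X]eq_Rintegral do rewrite cImM /=.
have iZ (c : R) (h : T -> R) : mu.-integrable setT (EFin \o h) ->
    mu.-integrable setT (EFin \o (fun x => c * h x)).
  move=> ih; have := integrableZl measurableT c ih.
  by apply: eq_integrable.
rewrite RintegralB//; [|exact: iZ|exact: iZ].
rewrite RintegralD//; [|exact: iZ|exact: iZ].
by rewrite !RintegralZl.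
Qed.

Lemma cintegral_ae_eq f g : cmeasurable f -> cmeasurable g ->
  f = g %[ae mu] -> cintegral mu f = cintegral mu g.
Proof.
move=> [f1 f2] [g1 g2] fg; rewrite /cintegral /Rintegral.
congr (fine _ +i* fine _); apply: ae_eq_integral => //;
  try exact/measurable_EFinP.
- exact: (ae_eq_comp (fun z : R[i] => (complex.Re z)%:E)).
- exact: (ae_eq_comp (fun z : R[i] => (complex.Im z)%:E)).
Qed.

Lemma cLfun_integrable (p : R) f : 1 <= p -> (mu setT < +oo)%E ->
  f \in cLfun mu p -> cintegrable f.
Proof.
move=> p1 muT /cLfunP[mf ff]; have p0 : 0 < p := lt_le_trans ltr01 p1.
have mn := cmeasurable_normc mf; case: (mf) => mre mim.
have fT : mu setT \is a fin_num by rewrite ge0_fin_numE// measure_ge0.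
have inorm : mu.-integrable setT (EFin \o (fun x => normc (f x))).
  apply/Lfun1_integrable.
  apply: (@Lfun_subset _ _ _ mu 1%E p%:E) => //.
  rewrite inE; apply/andP; split; rewrite inE//=.
split; apply: le_integrable inorm => //; try exact/measurable_EFinP.
- by move=> x _; rewrite /= lee_fin (ger0_norm (normc_ge0 _)) ler_Re_normc.
- by move=> x _; rewrite /= lee_fin (ger0_norm (normc_ge0 _)) ler_Im_normc.
Qed.

End cintegral_theory.

Section Lp.
Context d (T : measurableType d) (R : realType).
Variables (mu : {measure set T -> \bar R}) (p : R) (p1 : 1 <= p).

Let p0 : 0 < p := lt_le_trans ltr01 p1.

(* The predicate carries p1 so that its closure properties can be canonical. *)
Definition cLfun1 of 1 <= p : {pred T -> R[i]} := cLfun mu p.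

HB.instance Definition _ := GRing.isSubmodClosed.Build R[i] (T -> R[i])
  (cLfun1 p1) (cLfun_submod_closed mu p1).

Record LpFun := MkLpFun {
  LpFun_fun :> T -> R[i] ; LpFun_prop : LpFun_fun \in cLfun1 p1 }.

HB.instance Definition _ := [isSub for LpFun_fun].
HB.instance Definition _ := [Choice of LpFun by <:].
HB.instance Definition _ := [SubChoice_isSubLmodule of LpFun by <:].

Implicit Types f g : LpFun.

Lemma LpFun_cmeasurable f : cmeasurable f.
Proof. by have /cLfunP[] := LpFun_prop f. Qed.

Lemma LpFun_lty f : (cLnorm mu p f < +oo)%E.
Proof. by have /cLfunP[] := LpFun_prop f. Qed.

Lemma LpFun_fin_num f : cLnorm mu p f \is a fin_num.
Proof. by rewrite ge0_fin_numE ?LpFun_lty// Lnorm_ge0. Qed.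

Definition Lp_eq f g := `[< (f : T -> R[i]) = g %[ae mu] >].

Let Lp_eq_refl : reflexive Lp_eq.
Proof. by move=> f; apply/asboolP; exact: ae_eq_refl. Qed.

Let Lp_eq_sym : symmetric Lp_eq.
Proof. by move=> f g; apply/idP/idP => /asboolP h; apply/asboolP/ae_eq_sym. Qed.

Let Lp_eq_trans : transitive Lp_eq.
Proof.
by move=> f g h /asboolP gf /asboolP fh; apply/asboolP/(ae_eq_trans gf fh).
Qed.

Canonical Lp_eq_equiv := EquivRel Lp_eq Lp_eq_refl Lp_eq_sym Lp_eq_trans.

Local Open Scope quotient_scope.

Definition Lp : Type := {eq_quot Lp_eq}.
HB.instance Definition _ := Choice.on Lp.
HB.instance Definition _ := EqQuotient.on Lp.

Definition Lp_repr (x : Lp) : LpFun := repr x.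
Definition Lp_class (f : LpFun) : Lp := \pi_Lp f.

Lemma Lp_reprK : cancel Lp_repr Lp_class.
Proof. exact: reprK. Qed.

Lemma Lp_classP f g :
  Lp_class f = Lp_class g <-> (f : T -> R[i]) = g %[ae mu].
Proof.
split=> [/eqquotP/asboolP//|fg]; apply/eqquotP; exact/asboolP.
Qed.

Lemma Lp_classK f : (Lp_repr (Lp_class f) : T -> R[i]) = f %[ae mu].
Proof. by apply/Lp_classP; rewrite Lp_reprK. Qed.

Definition Lp_add (x y : Lp) : Lp := Lp_class (Lp_repr x + Lp_repr y).
Definition Lp_opp (x : Lp) : Lp := Lp_class (- Lp_repr x).
Definition Lp_scale (a : R[i]) (x : Lp) : Lp := Lp_class (a *: Lp_repr x).

Lemma Lp_addE f g : Lp_add (Lp_class f) (Lp_class g) = Lp_class (f + g).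
Proof.
by apply/Lp_classP; apply: filterS2 (Lp_classK f) (Lp_classK g) => x + + _;
  rewrite /= !fctE => /(_ I) -> /(_ I) ->.
Qed.

Lemma Lp_oppE f : Lp_opp (Lp_class f) = Lp_class (- f).
Proof.
by apply/Lp_classP; apply: filterS (Lp_classK f) => x + _;
  rewrite /= !fctE => /(_ I) ->.
Qed.

Lemma Lp_scaleE a f : Lp_scale a (Lp_class f) = Lp_class (a *: f).
Proof.
by apply/Lp_classP; apply: filterS (Lp_classK f) => x + _;
  rewrite /= !fctE => /(_ I) ->.
Qed.

Let Lp_ind (P : Lp -> Prop) : (forall f, P (Lp_class f)) -> forall x, P x.
Proof. by move=> h x; rewrite -[x]Lp_reprK. Qed.

Let Lp_addA : associative Lp_add.
Proof.
elim/Lp_ind => f; elim/Lp_ind => g; elim/Lp_ind => h.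
by rewrite !Lp_addE addrA.
Qed.

Let Lp_addC : commutative Lp_add.
Proof. by elim/Lp_ind => f; elim/Lp_ind => g; rewrite !Lp_addE addrC. Qed.

Let Lp_add0 : left_id (Lp_class 0) Lp_add.
Proof. by elim/Lp_ind => f; rewrite Lp_addE add0r. Qed.

Let Lp_addN : left_inverse (Lp_class 0) Lp_opp Lp_add.
Proof. by elim/Lp_ind => f; rewrite Lp_oppE Lp_addE addNr. Qed.

HB.instance Definition _ :=
  GRing.isZmodule.Build Lp Lp_addA Lp_addC Lp_add0 Lp_addN.

Let Lp_scaleA a b x : Lp_scale a (Lp_scale b x) = Lp_scale (a * b) x.
Proof. by elim/Lp_ind: x => f; rewrite !Lp_scaleE scalerA. Qed.

Let Lp_scale1 : left_id 1 Lp_scale.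
Proof. by elim/Lp_ind => f; rewrite Lp_scaleE scale1r. Qed.

Let Lp_scaleDr : right_distributive Lp_scale +%R.
Proof.
move=> a; elim/Lp_ind => f; elim/Lp_ind => g.
rewrite [in LHS]/GRing.add/= [in RHS]/GRing.add/=.
by rewrite Lp_addE !Lp_scaleE Lp_addE scalerDr.
Qed.

Let Lp_scaleDl x : {morph Lp_scale^~ x : a b / a + b}.
Proof.
move=> a b; elim/Lp_ind: x => f.
by rewrite [in RHS]/GRing.add/= !Lp_scaleE Lp_addE scalerDl.
Qed.

HB.instance Definition _ := GRing.Zmodule_isLmodule.Build R[i] Lp
  Lp_scaleA Lp_scale1 Lp_scaleDr Lp_scaleDl.

Lemma Lp_classD f g : Lp_class (f + g) = Lp_class f + Lp_class g.
Proof. by rewrite -Lp_addE. Qed.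

Lemma Lp_classZ a f : Lp_class (a *: f) = a *: Lp_class f.
Proof. by rewrite -Lp_scaleE. Qed.

Definition Lp_norm (x : Lp) : R := fine (cLnorm mu p (Lp_repr x)).

Lemma Lp_normE f : Lp_norm (Lp_class f) = fine (cLnorm mu p f).
Proof.
congr fine; apply: cLnorm_ae_eq; [exact: LpFun_cmeasurable..|].
exact: Lp_classK.
Qed.

Let Lp_normD x y : (Lp_norm (x + y))%:C <= (Lp_norm x)%:C + (Lp_norm y)%:C.
Proof.
elim/Lp_ind: x => f; elim/Lp_ind: y => g.
rewrite -rmorphD lecR -Lp_classD !Lp_normE -fineD ?LpFun_fin_num//.
apply: fine_le; rewrite ?fin_numD ?LpFun_fin_num//.
exact: cLnormD p1 (LpFun_cmeasurable f) (LpFun_cmeasurable g).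
Qed.

Let Lp_normZ a x : (Lp_norm (a *: x))%:C = `|a| * (Lp_norm x)%:C.
Proof.
elim/Lp_ind: x => f; rewrite -normcE -rmorphM; congr (_%:C).
rewrite -Lp_classZ !Lp_normE cLnormZ//; last exact: LpFun_cmeasurable.
by rewrite fineM// LpFun_fin_num.
Qed.

Let Lp_norm_eq0 x : (Lp_norm x)%:C = 0 -> x = 0.
Proof.
elim/Lp_ind: x => f /complexI; rewrite Lp_normE => f0.
have nf : cLnorm mu p f = 0%E by rewrite -(fineK (LpFun_fin_num f)) f0.
apply/(Lp_classP f 0); exact: cLnorm_eq0 p0 (LpFun_cmeasurable f) nf.
Qed.

HB.instance Definition _ := Lmodule_isNormed.Build R[i] Lp
  Lp_normD Lp_normZ Lp_norm_eq0.

Lemma Lp_normrE (x : Lp) : `|x| = (Lp_norm x)%:C.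
Proof. by []. Qed.

End Lp.

Section circle.
Variable R : realType.

Definition circle_points : Type := {z : R[i] | `|z| == 1}.

HB.instance Definition _ := Choice.on circle_points.
HB.instance Definition _ :=
  isPointed.Build circle_points (exist _ 1 (introT eqP (normr1 _))).

Definition circle_coord (z : circle_points) : R * R :=
  (complex.Re (val z), complex.Im (val z)).

(* The unit circle, with the trace of the Borel sets of the plane. *)
Definition circle : Type := g_sigma_algebra_preimageType circle_coord.

HB.instance Definition _ := Measurable.on circle.

Definition circle_val (z : circle) : R[i] := val (z : circle_points).

Lemma cis_subproof (t : R) : `|cos t +i* sin t| == 1.
Proof. by rewrite -normcE /= cos2Dsin2 sqrtr1. Qed.

Definition cis (t : measurableTypeR R) : circle := exist _ (cos t +i* sin t) (cis_subproof t).

Lemma measurable_circle_coord :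
  measurable_fun setT (circle_coord : circle -> R * R).
Proof. by move=> _ A mA; exists A. Qed.

Lemma measurable_cis : measurable_fun setT cis.
Proof.
move=> _ _ [A mA <-]; rewrite !setTI -comp_preimage -[X in measurable X]setTI.
have: measurable_fun setT (circle_coord \o cis).
  apply/measurable_fun_pair.
    apply: continuous_measurable_fun; exact: continuous_cos.
  apply: continuous_measurable_fun; exact: continuous_sin.
exact.
Qed.

HB.instance Definition _ := isMeasurableFun.Build _ _ _ _ cis measurable_cis.

Lemma pi2_gt0 : 0 < 2 * pi :> R.
Proof. by rewrite mulr_gt0// pi_gt0. Qed.

(* Normalized Lebesgue measure: the image of the uniform probability on       *)
(* [0, 2 pi] under t |-> e^(i t).                                             *)
Definition circle_measure : probability circle R :=
  distribution (uniform_prob pi2_gt0) (cis : {mfun measurableTypeR R >-> circle}).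

Definition fourier_coef (f : circle -> R[i]) (n : int) : R[i] :=
  cintegral circle_measure (fun z => f z * circle_val z ^ (- n)).

End circle.

Section fourier_theory.
Context {R : realType}.
Implicit Types f g : circle R -> R[i].
Local Notation mu := (circle_measure R).

Lemma normc_circle_val (z : circle R) : normc (circle_val z) = 1.
Proof.
by apply: complexI; rewrite normcE; exact/eqP/(valP (z : circle_points R)).
Qed.

Lemma normc_circle_valX (z : circle R) (n : int) : normc (circle_val z ^ n) = 1.
Proof.
apply: complexI; rewrite normcE; have nz : `|circle_val z| = 1.
  by rewrite -normcE normc_circle_val.
by case: n => n; rewrite /exprz ?normfV normrX nz expr1n ?invr1.
Qed.

Lemma cmeasurable_circle_valX (n : int) :
  cmeasurable (fun z : circle R => circle_val z ^ n).
Proof.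
have mc := @measurable_circle_coord R.
have mX k : cmeasurable (fun z : circle R => circle_val z ^+ k).
  elim: k => [|k ih]; first by split; exact: measurable_cst.
  under eq_fun do rewrite exprS.
  apply: cmeasurableM ih; split.
    exact: (measurableT_comp measurable_fst mc).
  exact: (measurableT_comp measurable_snd mc).
case: n => k; first exact: mX.
have [m1 m2] := mX k.+1.
have E z : circle_val z ^ Negz k = (circle_val z ^+ k.+1)^* :> R[i].
  have := normc_circle_valX z k.+1; rewrite /exprz.
  case: (_ ^+ _) => a b /= /(congr1 (fun x => x ^+ 2)).
  rewrite expr1n sqr_sqrtr ?addr_ge0 ?sqr_ge0// => ab1.
  by rewrite /GRing.inv /= ab1 !divr1.
have [reE imE] : ((fun z : circle R => complex.Re (circle_val z ^ Negz k)) =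
      (fun z => complex.Re (circle_val z ^+ k.+1))) /\
    ((fun z : circle R => complex.Im (circle_val z ^ Negz k)) =
      (fun z => - complex.Im (circle_val z ^+ k.+1))).
  by split; apply/funext => z; rewrite E; case: (_ ^+ _).
split; rewrite ?reE ?imE//.
exact: measurableT_comp (@oppr_measurable R setT) m2.
Qed.

Lemma cLfun_circle_valX (p : R) f (n : int) : 1 <= p ->
  f \in cLfun mu p -> (fun z => f z * circle_val z ^ n) \in cLfun mu p.
Proof.
move=> p1 /cLfunP[mf ff]; apply/cLfunP; split.
  exact/cmeasurableM/cmeasurable_circle_valX.
rewrite (_ : cLnorm _ _ _ = cLnorm mu p f)//; apply: eq_Lnorm => z.
by rewrite normcM normc_circle_valX mulr1.
Qed.

Lemma fourier_integrable (p : R) f (n : int) : 1 <= p ->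
  f \in cLfun mu p -> cintegrable mu (fun z => f z * circle_val z ^ n).
Proof.
move=> p1 fp; apply: (cLfun_integrable p1); last exact: cLfun_circle_valX.
by rewrite [X in (X < _)%E](_ : _ = 1%E) ?ltry//; exact: probability_setT.
Qed.

Lemma fourier_coef_lin (p : R) (a : R[i]) f g (n : int) : 1 <= p ->
  f \in cLfun mu p -> g \in cLfun mu p ->
  fourier_coef (a *: f + g) n = a * fourier_coef f n + fourier_coef g n.
Proof.
move=> p1 fp gp.
have fi := fourier_integrable (- n) p1 fp.
have gi := fourier_integrable (- n) p1 gp.
have af : a *: f \in cLfun mu p.
  have := (cLfun_submod_closed mu p1).2 a f 0 fp.
  by rewrite addr0; apply; exact: (cLfun_submod_closed mu p1).1.
rewrite /fourier_coef -cintegralZ//.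
rewrite -cintegralD//; last first.
  by have := fourier_integrable (- n) p1 af; under eq_fun do rewrite -mulrA.
by congr cintegral; apply/funext => z; rewrite !fctE mulrDl -mulrA.
Qed.

Lemma fourier_coef_ae_eq f g (n : int) : cmeasurable f -> cmeasurable g ->
  f = g %[ae mu] -> fourier_coef f n = fourier_coef g n.
Proof.
move=> mf mg fg; apply: cintegral_ae_eq.
- exact/cmeasurableM/cmeasurable_circle_valX.
- exact/cmeasurableM/cmeasurable_circle_valX.
exact: (ae_eq_comp2 (fun (z : circle R) (w : R[i]) => w * circle_val z ^ (- n))).
Qed.

End fourier_theory.

Section Hardy.
Variables (R : realType) (p : R) (p1 : 1 <= p).
Local Notation L := (Lp (circle_measure R) p1).

(* By hardyP this does not depend on the representative Lp_repr f. *)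
Definition hardy : {pred L} :=
  [pred f | `[< forall n : int, n < 0 -> fourier_coef (Lp_repr f) n = 0 >]].

Lemma hardyP (f : LpFun (circle_measure R) p1) : Lp_class f \in hardy <->
  forall n : int, n < 0 -> fourier_coef f n = 0.
Proof.
have E n : fourier_coef (Lp_repr (Lp_class f)) n = fourier_coef f n.
  apply: fourier_coef_ae_eq; [exact: LpFun_cmeasurable..|exact: Lp_classK].
split=> [/asboolP h n n0|h]; first by rewrite -E; exact: h.
by apply/asboolP => n n0; rewrite E; exact: h.
Qed.

Lemma hardy_submod_closed : submod_closed hardy.
Proof.
split.
  have -> : 0 = Lp_class (0 : LpFun (circle_measure R) p1) by [].
  apply/hardyP => n _; rewrite /fourier_coef /cintegral.
  have E (z : circle R) : (0 : LpFun (circle_measure R) p1) z *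
      circle_val z ^ (- n) = 0 by exact: mul0r.
  under eq_Rintegral do rewrite E.
  under [X in _ +i* X]eq_Rintegral do rewrite E.
  by rewrite Rintegral_cst//= mul0r.
move=> a x y; rewrite -[x]Lp_reprK -[y]Lp_reprK.
move: (Lp_repr x) (Lp_repr y) => f g /hardyP fH /hardyP gH.
rewrite -Lp_classZ -Lp_classD; apply/hardyP => n n0.
rewrite (fourier_coef_lin a n p1 (LpFun_prop f) (LpFun_prop g)).
by rewrite fH// gH// mulr0 addr0.
Qed.

HB.instance Definition _ := GRing.isSubmodClosed.Build R[i] L
  hardy hardy_submod_closed.

Record Hp := MkHp { Hp_val :> L ; Hp_prop : Hp_val \in hardy }.

HB.instance Definition _ := [isSub for Hp_val].
HB.instance Definition _ := [Choice of Hp by <:].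
HB.instance Definition _ := [SubChoice_isSubLmodule of Hp by <:].

Let Hp_norm (x : Hp) : R[i] := `|Hp_val x|.

Let Hp_normD x y : Hp_norm (x + y) <= Hp_norm x + Hp_norm y.
Proof. exact: ler_normD. Qed.

Let Hp_normZ a x : Hp_norm (a *: x) = `|a| * Hp_norm x.
Proof. exact: normrZ. Qed.

Let Hp_norm_eq0 x : Hp_norm x = 0 -> x = 0.
Proof. by move=> /normr0_eq0 x0; apply: val_inj. Qed.

HB.instance Definition _ := Lmodule_isNormed.Build R[i] Hp
  Hp_normD Hp_normZ Hp_norm_eq0.

Lemma Hp_normE (x : Hp) : `|x| = `|Hp_val x|.
Proof. by []. Qed.

End Hardy.

Section complemented.
Context {R : realType}.
Implicit Type X : normedModType R[i].

Definition projection X (P : {linear X -> X}) : Prop :=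
  (exists x, P x != 0) /\ (forall x, P (P x) = P x).

Definition operator_norm X (P : {linear X -> X}) : \bar R :=
  ereal_sup [set (complex.Re `|P x|)%:E | x in [set x : X | `|x| <= 1]].

Definition contractive_projection X (P : {linear X -> X}) : Prop :=
  projection P /\ operator_norm P = 1%E.

Definition closed_subspace X (Y : set X) : Prop :=
  submod_closed (mem Y) /\ closed Y.

Definition one_complemented X (Y : set X) : Prop :=
  closed_subspace Y /\
  exists P : {linear X -> X}, contractive_projection P /\ range P = Y.

(* dim (X / Y) < oo: finitely many classes modulo Y span the quotient. *)
Definition finite_codimension X (Y : set X) : Prop :=
  exists (n : nat) (e : 'I_n -> X), forall x : X,
    exists (c : 'I_n -> R[i]), Y (x - \sum_(i < n) c i *: e i).

End complemented.

(* Main.v *)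
Require Import Defs.
From mathcomp Require Import all_boot all_order all_algebra.
From mathcomp Require Import generic_quotient complex.
From mathcomp Require Import all_classical all_reals all_analysis.
From mathcomp Require Import measurable_realfun ring lra.

(** Why the theorem is true.  Let Y be the range of a contractive projection P
    of H^p, proper and of finite codimension, and let v = x - P x be nonzero.
    Then P v = 0, so |f| = |P (f + s v)| <= |f + s v| for every f in Y and every
    scalar s: moving off Y in the direction v never shortens a vector.  It is
    shown that this forces all Fourier coefficients of v to vanish.

    The monomials z^k escape to infinity in so spread out a way that a subspace
    of finite codimension cannot avoid them: the distance from z^k to Y tends to
    0 [spread_monomial, spread_finite_codimension].  Hence, k being large, each
    of the trigonometric polynomials
      f = w1 z^k + d w2 z^k + d w1 w2 z^(2k-j),   d small, |w1| = |w2| = 1,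
    is nearly in Y and nearly satisfies the inequality above [energy_probe_le].

    Write f = w1 z^k (1 + e) with e = d w2 (z^(k-j) + conj w1).  The derivative
    at s = 0 of the integral of |f + s v|^p is p times the real part of the
    integral of |f|^(p-2) conj(f) v, where
      |1 + e|^(p-2) (1 + conj e) = 1 + (p/2 - 1) e + (p/2) conj e + ...
    contains the second order term (p/2) (p/2 - 1) |e|^2.  Averaging over the
    fourth roots of unity w1, w2 kills every other term of order at most two,
    and of |e|^2 only the cross term d^2 z^(k-j) w1 survives
    [sum_normc_perturbation_le].  After integration the averaged derivative in the
    direction s is, up to O(d^3), a positive multiple of (p - 2) d^2 Re (s c),
    where c is the j-th Fourier coefficient of v [sum_energy_probe_le].  It has
    to be nonnegative for all s, so c = 0, because p <> 2 [fourier_coef_eq0].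
    For negative indices the coefficients vanish by definition of H^p.

    An integrable function whose Fourier coefficients all vanish is 0
    [fourier_uniqueness], which contradicts v <> 0. *)

Set Implicit Arguments.
Unset Strict Implicit.
Unset Printing Implicit Defensive.
Import Order.TTheory GRing.Theory Num.Theory.
Import ComplexField.Normc.
Import numFieldNormedType.Exports.

Local Open Scope classical_set_scope.
Local Open Scope ring_scope.
Local Open Scope complex_scope.

(** * Subspaces of finite codimension and spread sequences *)

Section spread.
Context {K : numFieldType} {V : normedModType K}.
Implicit Types (W : set V) (x : nat -> V).

(** Long sums with unimodular coefficients have small average.  This is a form of
    weak convergence to 0 that is stated with norms alone, so it can be used
    without any knowledge of the dual space. *)
Definition spread x := forall e : K, 0 < e -> exists2 J : nat, (0 < J)%N &
  forall (s : seq nat) (th : nat -> K), uniq s -> size s = J ->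
    (forall k, `|th k| = 1) -> `|\sum_(k <- s) th k *: x k| <= e * J%:R.

Definition approaches x W := forall e : K, 0 < e ->
  exists k0, forall k, (k0 <= k)%N -> exists2 w, W w & `|x k - w| <= e.

Lemma frequently_uniq (P : nat -> Prop) (J : nat) :
  (forall k0, exists2 k, (k0 <= k)%N & P k) ->
  exists s : seq nat, [/\ uniq s, size s = J & forall k, k \in s -> P k].
Proof.
move=> Pinf; suff [s [us ss sP _]] : exists s : seq nat, [/\ uniq s, size s = J,
    forall k, k \in s -> P k & exists b, forall k, k \in s -> (k < b)%N].
  by exists s.
elim: J => [|J [s [us ss sP [b sb]]]]; first by exists [::]; split=> //; exists 0%N.
have [k bk Pk] := Pinf b; exists (k :: s); split.
- rewrite /= us andbT; apply/negP => /sb; by rewrite ltnNge bk.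
- by rewrite /= ss.
- by move=> l; rewrite inE => /orP[/eqP->//|/sP].
exists k.+1 => l; rewrite inE ltnS => /orP[/eqP->//|/sb/ltnW lb].
exact: leq_trans lb bk.
Qed.

Lemma not_approaches x W : ~ approaches x W -> exists2 e : K, 0 < e &
  forall k0, exists2 k, (k0 <= k)%N & forall w, W w -> e < `|x k - w|.
Proof.
move=> /existsNP[e] /not_implyP[e0] /forallNP h; exists e => // k0.
have /existsNP[k /not_implyP[kk0 nk]] := h k0.
exists k => // w Ww; rewrite real_ltNge ?(gtr0_real e0) ?normr_real//.
by apply/negP => xw; apply: nk; exists w.
Qed.

(** If u is in the closure of W, then W and W + K u have the same closure.
    Otherwise u stays at a distance d > 0 from W, and coefficients c_k of size
    at least a could be made to add up, by unimodular factors, to a multiple of u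
    of norm at least a d J modulo W, against the spreading of x. *)
Lemma spread_approaches x W (u : V) : submod_closed (mem W) -> spread x ->
  approaches x [set v | exists c, W (v - c *: u)] -> approaches x W.
Proof.
move=> [W0 WD] sx xW; apply: contrapT => /not_approaches[e e0 bad].
have WZ a v : W v -> W (a *: v).
  by move=> /mem_set Wv; apply/set_mem; rewrite -[_ *: _]addr0; exact: WD.
have WA v w : W v -> W w -> W (v + w).
  by move=> /mem_set Wv /mem_set Ww; apply/set_mem; rewrite -[v]scale1r; exact: WD.
have Wsum (I : Type) (r : seq I) (F : I -> V) : (forall i, W (F i)) -> W (\sum_(i <- r) F i).
  move=> WF; elim: r => [|i r ih]; first by rewrite big_nil; exact: set_mem.
  by rewrite big_cons; exact: WA.
(* Either u is at a distance at least d > 0 from W, or it is in its closure. *)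
have [[d d0 ud]|nd] := pselect (exists2 d : K, 0 < d & forall w, W w -> d <= `|u - w|);
    last first.
  have e2 : 0 < e / 2%:R by rewrite divr_gt0.
  have [k0 h] := xW _ e2.
  have [k kk0 xk] := bad k0.
  have [v [c Wvc] xv] := h _ kk0.
  have c1 : 0 < `|c| + 1 by rewrite ltr_wpDl.
  have [w Ww uw] : exists2 w, W w & `|u - w| < e / 2%:R / (`|c| + 1).
    apply: contrapT => nw; apply: nd; exists (e / 2%:R / (`|c| + 1)); first exact: divr_gt0.
    move=> w Ww; rewrite real_leNgt ?normr_real ?gtr0_real ?divr_gt0//.
    by apply/negP => uw; apply: nw; exists w.
  have := xk _ (WA _ _ Wvc (WZ c _ Ww)); apply/negP;
      rewrite -real_leNgt ?normr_real ?gtr0_real//.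
  rewrite [e]splitr (_ : x k - (v - c *: u + c *: w) = x k - v + c *: (u - w)); last first.
    by rewrite scalerBr !opprD opprK !addrA.
  apply: le_trans (ler_normD _ _) _; apply: lerD => //.
  rewrite normrZ; apply: le_trans (_ : (`|c| + 1) * `|u - w| <= _).
    by rewrite ler_wpM2r// lerDl.
  by rewrite mulrC -ler_pdivlMr// ltW.
(* At a bad index k the coefficient of u is at least a, since x k is e-far from
   W and r-close to W + K u with r <= e / 2. *)
pose a := e / (2 * (`|u| + 1)).
have u1 : 0 < `|u| + 1 by rewrite ltr_wpDl.
have a0 : 0 < a by rewrite divr_gt0// mulr_gt0.
have ad0 : 0 < a * d / 4 by rewrite divr_gt0// mulr_gt0.
have e20 : 0 < e / 2 by rewrite divr_gt0.
have [r [r0 re rad]] : exists r, [/\ 0 < r, r <= e / 2 & r <= a * d / 4].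
  by have /orP[h|h] := real_leVge (gtr0_real e20) (gtr0_real ad0);
      [exists (e / 2)|exists (a * d / 4)].
have [k0 xk0] := xW _ r0.
have [J J0 xJ] := sx _ ad0.
pose P k c := a <= `|c| /\ exists2 v, W (v - c *: u) & `|x k - v| <= r.
have [s [us ss sP]] : exists s : seq nat, [/\ uniq s, size s = J &
    forall k, k \in s -> exists c, P k c].
  apply: frequently_uniq => k1; have [k] := bad (maxn k0 k1).
  rewrite geq_max => /andP[kk0 kk1] xk; exists k => //.
  have [v [c Wvc] xv] := xk0 _ kk0; exists c; split; last by exists v.
  have := xk _ Wvc; rewrite opprB addrCA addrC => h.
  have {}h : e < r + `|c| * `|u|.
    apply: lt_le_trans h _; rewrite addrC -normrZ addrC; apply: le_trans (ler_normD _ _) _.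
    by rewrite lerD2r.
  rewrite /a invfM mulrA ler_pdivrMr// mulrDr mulr1.
  apply: le_trans (_ : `|c| * `|u| <= _); last by rewrite lerDl.
  rewrite -(lerD2l (e / 2)) -splitr; apply: le_trans (ltW h) _; by rewrite lerD2r.
have [c cP] : exists c : nat -> K, forall k, k \in s -> P k (c k).
  have : forall k, exists c, k \in s -> P k c.
    by move=> k; have [/sP[c Pc]|] := boolP (k \in s); [exists c|exists 0].
  by move=> /choice[c cP]; exists c.
have c0 k : k \in s -> 0 < `|c k| by move=> /cP[+ _]; exact: lt_le_trans.
have [v vP] : exists v : nat -> V, forall k, k \in s -> W (v k - c k *:
    u) /\ `|x k - v k| <= r.
  have : forall k, exists v, k \in s -> W (v - c k *: u) /\ `|x k - v| <= r.
    move=> k; have [/cP[_ [v ? ?]]|] := boolP (k \in s); first by exists v.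
    by exists 0.
  by move=> /choice[v vP]; exists v.
(* Outside s the value only has to be unimodular. *)
pose th k := if k \in s then `|c k| / c k else 1.
have th1 k : `|th k| = 1.
  rewrite /th; case: ifP => [/c0 ck|_]; last exact: normr1.
  by rewrite normf_div normr_id divff ?gt_eqF.
have := xJ s th us ss th1; apply/negP; rewrite -real_ltNge ?normr_real ?gtr0_real ?mulr_gt0
    ?ltr0n//.
have JR : 0 < J%:R :> K by rewrite ltr0n.
have sumr1 (F : nat -> V) : (forall k, k \in s -> `|F k| <= r) -> `|\sum_(k <- s) th k *:
    F k| <= r * J%:R.
  move=> Fr; apply: le_trans (ler_norm_sum _ _ _) _.
  rewrite -ss -sum1_size natr_sum mulr_sumr big_seq [leRHS]big_seq; apply: ler_sum => k ks.
  by rewrite normrZ th1 mul1r mulr1; exact: Fr.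
have B0 : a * J%:R <= \sum_(k <- s) `|c k|.
  rewrite -ss -sum1_size natr_sum mulr_sumr big_seq [leRHS]big_seq; apply: ler_sum => k ks.
  by rewrite mulr1; have [] := cP _ ks.
have Bp : 0 < \sum_(k <- s) `|c k| by apply: lt_le_trans B0; rewrite mulr_gt0.
have Ww : W (\sum_(k <- s) th k *: (if k \in s then v k - c k *: u else 0)).
  apply: Wsum => k; apply: WZ; case: ifP => [/vP[]//|_]; exact: set_mem.
have vE : \sum_(k <- s) th k *: v k = \sum_(k <- s) th k *: (if k \in s then v k - c k *:
    u else 0) + (\sum_(k <- s) `|c k|) *: u.
  rewrite scaler_suml -big_split/= [LHS]big_seq [RHS]big_seq; apply: eq_bigr => k ks.
  rewrite ks scalerBr scalerA /th ks mulfVK ?subrK//.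
  by rewrite -normr_eq0 gt_eqF// c0.
have vlow : a * J%:R * d <= `|\sum_(k <- s) th k *: v k|.
  rewrite vE; set b := \sum_(k <- s) `|c k| in Bp B0 *; set w := \sum_(k <- s) _ in Ww *.
  have -> : w + b *: u = b *: (u - (- b^-1) *: w).
    by rewrite scaleNr opprK scalerDr scalerA mulfV ?gt_eqF// scale1r addrC.
  rewrite normrZ gtr0_norm//; apply: ler_pM; [by rewrite mulr_ge0 ?ltW|exact: ltW|exact: B0|].
  exact/ud/WZ.
have -> : \sum_(k <- s) th k *: x k = \sum_(k <- s) th k *: v k + \sum_(k <- s) th k *:
    (x k - v k).
  by rewrite -big_split/=; apply: eq_bigr => k _; rewrite -scalerDr addrCA subrr addr0.
have xv := sumr1 (fun k => x k - v k) (fun k ks => (vP k ks).2).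
apply: lt_le_trans (lerB_normD _ _); rewrite ltrBrDr.
apply: lt_le_trans vlow; apply: le_lt_trans (lerD (lexx _) xv) _.
rewrite -mulrDl [ltRHS]mulrAC ltr_pM2r//.
apply: le_lt_trans (_ : _ <= a * d / 4 + a * d / 4) _; first by rewrite lerD2l.
have -> : a * d / 4 + a * d / 4 = a * d / 2 by field.
by rewrite ltr_pdivrMr// ltr_pMr ?mulr_gt0// ltr1n.
Qed.

(** Induction on the codimension, adding one generator at a time. *)
Lemma spread_finite_codimension (Y : set V) x n (e : 'I_n -> V) :
  submod_closed (mem Y) -> spread x ->
  (forall v, exists c : 'I_n -> K, Y (v - \sum_(i < n) c i *: e i)) ->
  approaches x Y.
Proof.
move=> + sx; elim: n Y e => [|n ih] Y e sY eY.
  move=> r r0; exists 0%N => k _; exists (x k); last by rewrite subrr normr0 ltW.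
  by have [c] := eY (x k); rewrite big_ord0 subr0.
apply: (spread_approaches (u := e ord_max) sY sx).
apply: (ih _ (fun i => e (widen_ord (leqnSn n) i))); last first.
  move=> v; have [c] := eY v; rewrite big_ord_recr/= opprD addrA => h.
  by exists (fun i => c (widen_ord (leqnSn n) i)), (c ord_max).
case: sY => Y0 YD; split; first by apply/mem_set; exists 0; rewrite scale0r subr0; exact:
    set_mem.
move=> b v w /set_mem[cv Yv] /set_mem[cw Yw]; apply/mem_set; exists (b * cv + cw).
have /set_mem := YD b _ _ (mem_set Yv) (mem_set Yw).
by rewrite scalerBr scalerA scalerDl opprD addrACA.
Qed.

End spread.

(** * Taylor expansion of real powers *)

Section real_powers.
Context {R : realType}.
Implicit Types q t u : R.

Lemma powR_near1_le q t : 1 / 2 <= t <= 3 / 2 -> t `^ q <= 2 `^ `|q|.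
Proof.
move=> /andP[t1 t2]; have t0 : 0 < t by lra.
have [q0|q0] := ger0P q.
  by apply: ge0_ler_powR; rewrite ?nnegrE; lra.
rewrite -[q in t `^ q]opprK -mulN1r powRrM powR_inv1 ?(ltW t0)//.
apply: ge0_ler_powR; rewrite ?nnegrE ?invr_ge0 ?oppr_ge0 ?(ltW t0) ?(ltW q0)//.
by rewrite -[2]invrK lef_pV2 ?posrE; lra.
Qed.

(** The mean value theorem, in the form that raises the order of vanishing at 0. *)
Lemma le_expr_of_derive (F dF : R -> R) (M r : R) n :
  0 <= M ->
  (forall u, `|u| <= r -> is_derive u 1 F (dF u)) -> F 0 = 0 ->
  (forall u, `|u| <= r -> `|dF u| <= M * `|u| ^+ n) ->
  forall u, `|u| <= r -> `|F u| <= M * `|u| ^+ n.+1.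
Proof.
move=> M0 dFE F0 dFle u ur.
suff [c cu Fu] : exists2 c, `|c| <= `|u| & F u = dF c * u.
  rewrite Fu normrM exprSr mulrA ler_wpM2r//.
  apply: le_trans (dFle _ (le_trans cu ur)) _.
  by rewrite ler_wpM2l// lerXn2r ?nnegrE.
have cts a b : (forall x, x \in `[a, b] -> `|x| <= r) -> {within `[a, b], continuous F}.
  move=> ab; apply: derivable_within_continuous => x xab.
  by have := dFE x (ab x xab); case=> + _; exact.
have [u0|u0] := leP 0 u.
  have sub x : x \in `[0, u] -> `|x| <= r.
    rewrite in_itv/= => /andP[x0 xu]; rewrite ger0_norm//.
    by apply: le_trans ur; rewrite ger0_norm.
  have dFu x : x \in `]0, u[ -> is_derive x 1 F (dF x).
    by move=> xu; apply/dFE/sub; move: xu; rewrite !in_itv/= => /andP[/ltW-> /ltW->].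
  have [c] := MVT_segment u0 dFu (cts _ _ sub).
  rewrite in_itv/= => /andP[c0 cu]; rewrite F0 !subr0 => Fu; exists c => //.
  by rewrite !ger0_norm.
have sub x : x \in `[u, 0] -> `|x| <= r.
  rewrite in_itv/= => /andP[x0 xu]; rewrite ler0_norm//.
  by apply: le_trans ur; rewrite ltr0_norm// lerN2.
have dFu x : x \in `]u, 0[ -> is_derive x 1 F (dF x).
  by move=> xu; apply/dFE/sub; move: xu; rewrite !in_itv/= => /andP[/ltW-> /ltW->].
have [c] := MVT_segment (ltW u0) dFu (cts _ _ sub).
rewrite in_itv/= => /andP[c0 cu]; rewrite F0 sub0r => Fu; exists c.
  by rewrite ler0_norm// ltr0_norm// lerN2.
by apply: oppr_inj; rewrite Fu sub0r mulrN.
Qed.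

Lemma is_derive_powR1D q u : `|u| <= 1 / 2 ->
  is_derive u 1 (fun u => (1 + u) `^ q) (q * (1 + u) `^ (q - 1)).
Proof.
move=> ur; have u1 : 0 < 1 + u by move: ur; rewrite ler_norml; lra.
have := is_derive1_comp (is_derive1_powR q u1) (is_deriveD (is_derive_cst (1 :
    R) u 1) (is_derive_id u 1)).
by rewrite add0r mulr1.
Qed.

Lemma powR1D_le0 q u : `|u| <= 1 / 2 -> `|(1 + u) `^ q| <= 2 `^ `|q|.
Proof.
move=> ur; rewrite ger0_norm ?powR_ge0//; apply: powR_near1_le.
by move: ur; rewrite ler_norml; lra.
Qed.

(** The remainder of order n + 1 for the exponent q has derivative q times the
    remainder of order n for the exponent q - 1; hence this bound and the next
    two, each obtained from the one before. *)
Lemma powR1D_le1 q u : `|u| <= 1 / 2 ->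
  `|(1 + u) `^ q - 1| <= `|q| * 2 `^ `|q - 1| * `|u|.
Proof.
move=> ur; rewrite -[X in _ * X]expr1.
apply: (@le_expr_of_derive (fun u => (1 + u) `^ q - 1)
  (fun u => q * (1 + u) `^ (q - 1)) _ (1 / 2) 0) => //.
- move=> v vr; have := is_deriveB (is_derive_powR1D q vr) (is_derive_cst (1 : R) v 1).
  by rewrite subr0.
- by rewrite addr0 powR1 subrr.
- move=> v vr; rewrite expr0 mulr1 normrM ler_wpM2l//; exact: powR1D_le0.
Qed.

Lemma powR1D_le2 q : exists2 C : R, 0 <= C & forall u, `|u| <= 1 / 2 ->
  `|(1 + u) `^ q - 1 - q * u| <= C * `|u| ^+ 2.
Proof.
exists (`|q| * (`|q - 1| * 2 `^ `|q - 1 - 1|)); first by rewrite !mulr_ge0// powR_ge0.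
apply: (@le_expr_of_derive (fun u => (1 + u) `^ q - 1 - q * u)
  (fun u => q * ((1 + u) `^ (q - 1) - 1)) _ (1 / 2) 1) => //.
- move=> v vr; have := is_deriveB (is_deriveB (is_derive_powR1D q vr) (is_derive_cst (1 :
    R) v 1)) (is_deriveZ q (is_derive_id v (1 : R))).
  by rewrite subr0 /GRing.scale/= mulrBr.
- by rewrite addr0 powR1 subrr mulr0 subr0.
- by move=> v vr; rewrite expr1 normrM -!mulrA ler_wpM2l// mulrA powR1D_le1.
Qed.

Lemma powR1D_le3 q : exists2 C : R, 0 <= C & forall u, `|u| <= 1 / 2 ->
  `|(1 + u) `^ q - 1 - q * u - q * (q - 1) / 2 * u ^+ 2| <= C * `|u| ^+ 3.
Proof.
have [C C0 le2] := powR1D_le2 (q - 1).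
exists (`|q| * C); first by rewrite !mulr_ge0.
apply: (@le_expr_of_derive (fun u => (1 + u) `^ q - 1 - q * u - q * (q - 1) / 2 * u ^+ 2)
  (fun u => q * ((1 + u) `^ (q - 1) - 1 - (q - 1) * u)) _ (1 / 2) 2) => //.
- exact: mulr_ge0.
- move=> v vr; have := is_deriveB (is_deriveB (is_deriveB (is_derive_powR1D q vr)
    (is_derive_cst (1 : R) v 1)) (is_deriveZ q (is_derive_id v (1 :
        R)))) (is_deriveZ (q * (q - 1) / 2) (is_deriveM (is_derive_id v (1 :
            R)) (is_derive_id v (1 : R)))).
  set D := (X in is_derive _ _ _ X); suff -> : D =
      q * ((1 + v) `^ (q - 1) - 1 - (q - 1) * v) by [].
  by rewrite /D /GRing.scale/=; field.
- by rewrite addr0 powR1; ring.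
- by move=> v vr; rewrite normrM -!mulrA ler_wpM2l//; exact: le2.
Qed.

End real_powers.

(** * First order expansion of the p-th power of a modulus *)

Section complex_taylor.
Context {R : realType}.
Implicit Types (x y z e w : R[i]) (p r : R).

Lemma normc_sqr z : normc z ^+ 2 = complex.Re z ^+ 2 + complex.Im z ^+ 2.
Proof. by case: z => a b /=; rewrite sqr_sqrtr ?addr_ge0 ?sqr_ge0. Qed.

Lemma normc_conj z : normc z^*%C = normc z.
Proof. by case: z => a b /=; rewrite sqrrN. Qed.

Lemma normc_sqrD x y : normc (x + y) ^+ 2 =
  normc x ^+ 2 + 2 * complex.Re (x^*%C * y) + normc y ^+ 2.
Proof. by rewrite !normc_sqr; case: x y => [a b] [c d] /=; ring. Qed.

Lemma ler_Re z : complex.Re z <= normc z.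
Proof. exact: le_trans (ler_norm _) (ler_Re_normc z). Qed.

(** The size of the error in the first order expansion of |x + y|^p when |x| is
    close to 1.  The regime of large r keeps it integrable for y in L^p; the
    quadratic regime makes it o(t) when y is replaced by t y. *)
Definition gauge p r := if r <= 1 / 16 then r ^+ 2 else r `^ p.

Lemma gauge_ge0 p r : 0 <= gauge p r.
Proof. by rewrite /gauge; case: ifP => _; rewrite ?sqr_ge0 ?powR_ge0. Qed.

(** For small y, apply the expansion of (1 + u)^(p/2) to
    |x + y|^2 = |x|^2 (1 + u); for large y every term is dominated by |y|^p. *)
Lemma normcD_powR_le p : 1 <= p -> exists2 C : R, 0 <= C & forall x y,
  1 / 2 <= normc x <= 3 / 2 -> normc (x + y) `^ p <=
  normc x `^ p + p * (normc x `^ (p - 2) * complex.Re (x^*%C * y)) + C * gauge p (normc y).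
Proof.
move=> p1; have [C1 C10 tay] := powR1D_le2 (p / 2).
pose A := 2 `^ `|p - 2| : R; pose B := 2 `^ `|p| : R; pose D := 2 `^ `|p - 1| : R.
have A0 : 0 <= A by exact: powR_ge0.
have B0 : 0 <= B by exact: powR_ge0.
have D0 : 0 <= D by exact: powR_ge0.
exists ((A * (p / 2) + B * C1 * 25) + (25 `^ p + p * D * 16 `^ p)).
  by rewrite !addr_ge0 ?mulr_ge0 ?powR_ge0 //; lra.
move=> x y xb; have /andP[x1 x2] := xb.
have x0 : 0 < normc x by lra.
have y0 := normc_ge0 y.
have xp q : normc x `^ q <= 2 `^ `|q| by exact: powR_near1_le.
have re : `|complex.Re (x^*%C * y)| <= normc x * normc y.
  by apply: le_trans (ler_Re_normc _) _; rewrite normcM normc_conj.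
(* The constant 25 comes from 3/2 <= 24 |y|, the range of y being |y| > 1/16. *)
rewrite /gauge; case: ifPn => [y16|]; last first.
  rewrite -ltNge => y16.
  have yp : normc y <= 16 `^ p * normc y `^ p.
    rewrite -powRM//; apply: le_trans (_ : 16 * normc y <= _); first lra.
    by apply: le1r_powR; lra.
  have xyp : normc (x + y) `^ p <= 25 `^ p * normc y `^ p.
    rewrite -powRM//; apply: ge0_ler_powR; rewrite ?nnegrE ?normc_ge0//; try lra.
    by apply: le_trans (ler_normcD _ _) _; lra.
  have lin : - (p * (normc x `^ (p - 2) * complex.Re (x^*%C * y))) <=
      p * D * (16 `^ p * normc y `^ p).
    rewrite -mulrN -mulrN -mulrA; apply: ler_wpM2l; first lra.
    apply: le_trans (_ : normc x `^ (p - 2) * (normc x * normc y) <= _).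
      rewrite ler_wpM2l ?powR_ge0//; apply: le_trans re; by rewrite -normrN ler_norm.
    rewrite (mulrA (normc x `^ _)) [X in X * normc y <= _]mulrC.
    have -> : p - 2 = (p - 1) - 1 by ring.
    rewrite -[X in X * normc x `^ _]powRr1 ?(ltW x0)// -powRD ?(gt_eqF x0) ?implybT//.
    have -> : 1 + (p - 1 - 1) = p - 1 by ring.
    by apply: ler_pM; rewrite ?powR_ge0// xp.
  have xp0 := powR_ge0 (normc x) p.
  have yp0 := powR_ge0 (normc y) p.
  have K0 : 0 <= (A * (p / 2) + B * C1 * 25) * normc y `^ p.
    by rewrite mulr_ge0// !addr_ge0 ?mulr_ge0 //; lra.
  lra.
pose a := normc x ^+ 2; pose v := 2 * complex.Re (x^*%C * y) + normc y ^+ 2.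
have a0 : 0 < a by rewrite /a exprn_gt0.
pose u := v / a.
have va : normc (x + y) ^+ 2 = a * (1 + u).
  by rewrite normc_sqrD mulrDr mulr1 /u [a * (_ / _)]mulrC divfK ?gt_eqF// addrA.
have vle : `|v| <= 5 * normc y * a.
  rewrite /v; apply: le_trans (ler_normD _ _) _.
  rewrite normrM (ger0_norm (sqr_ge0 _)) (ger0_norm (ler0n _ 2)) /a.
  have h1 : normc x * normc y <= 2 * normc x ^+ 2 * normc y.
    by rewrite ler_wpM2r//; nra.
  have h2 : normc y * normc y <= normc x ^+ 2 * normc y by rewrite ler_wpM2r//; nra.
  lra.
have ule : `|u| <= 5 * normc y.
  by rewrite /u normrM normfV (gtr0_norm a0) ler_pdivrMr.
have u12 : `|u| <= 1 / 2 by lra.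
have u1 : 0 <= 1 + u by move: u12; rewrite ler_norml; lra.
have sqp z : normc z `^ p = (normc z ^+ 2) `^ (p / 2).
  rewrite -powR_mulrn ?normc_ge0// -powRrM; congr (_ `^ _); by field.
have xpa : a `^ (p / 2) = normc x `^ p by rewrite sqp.
have xpb : a `^ (p / 2) / a = normc x `^ (p - 2).
  rewrite xpa /a -powR_mulrn ?(ltW x0)// -powRB//.
  by rewrite (gt_eqF x0) implybT.
have := tay _ u12; rewrite ler_norml => /andP[_ T].
have T2 : (1 + u) `^ (p / 2) <= 1 + p / 2 * u + C1 * (25 * normc y ^+ 2).
  apply: le_trans (_ : 1 + p / 2 * u + C1 * `|u| ^+ 2 <= _); first lra.
  rewrite lerD2l ler_wpM2l//.
  have -> : 25 * normc y ^+ 2 = (5 * normc y) ^+ 2 by ring.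
  by rewrite lerXn2r ?nnegrE// mulr_ge0.
rewrite (sqp (x + y)) va powRM ?(ltW a0)// xpa.
apply: le_trans (ler_wpM2l (powR_ge0 _ _) T2) _.
have -> : normc x `^ p * (1 + p / 2 * u + C1 * (25 * normc y ^+ 2)) =
  normc x `^ p + p * (normc x `^ (p - 2) * complex.Re (x^*%C * y)) +
  (normc x `^ (p - 2) * (p / 2) + normc x `^ p * C1 * 25) * normc y ^+ 2.
  rewrite -xpb xpa /u /v; field; by rewrite gt_eqF.
rewrite lerD2l ler_wpM2r ?sqr_ge0// ler_wpDr//.
  by rewrite addr_ge0 ?mulr_ge0 ?powR_ge0//; lra.
apply: lerD; first by rewrite ler_wpM2r ?xp//; lra.
by rewrite ler_wpM2r// ler_wpM2r// xp.
Qed.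

End complex_taylor.

(** * Second order expansion and averaging over the fourth roots of unity *)

Section averaging.
Context {R : realType}.
Implicit Types (x y z e w : R[i]) (p q r : R).

Lemma normc_real r : normc r%:C = `|r|.
Proof. by rewrite /= expr0n addr0 sqrtr_sqr. Qed.

(** The Taylor polynomial of degree 2 of |1 + e|^(2q) (1 + conj e), in which e'
    stands for conj e so that the polynomial identities below are purely algebraic. *)
Definition jet q (e e' : R[i]) : R[i] :=
  1 + q%:C * (e + e') + e' + q%:C * (e * e') +
  (q * (q - 1) / 2)%:C * (e + e') ^+ 2 + q%:C * ((e + e') * e').

(** Here |1 + e|^2 = 1 + u with u = e + conj e + |e|^2, so the expansion of
    (1 + u)^q to order 2 gives all the terms of degree at most 2. *)
Lemma conj_powR_jet_le q : exists2 C : R, 0 <= C & forall e, normc e <= 1 / 8 ->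
  normc (((normc (1 + e) ^+ 2) `^ q)%:C * (1 + e)^*%C - jet q e e^*%C) <= C * normc e ^+ 3.
Proof.
have [C1 C10 tay] := powR1D_le3 q.
pose c := q * (q - 1) / 2.
exists (`|c| * 14 + `|q| + C1 * 54).
  by rewrite !addr_ge0 ?mulr_ge0//.
move=> e e8; have e0 := normc_ge0 e.
pose u := 2 * complex.Re e + normc e ^+ 2.
have u1 : normc (1 + e) ^+ 2 = 1 + u.
  by rewrite normc_sqrD normc1 expr1n /u rmorph1 mul1r addrA.
have re := ler_Re_normc e.
have ule : `|u| <= 3 * normc e.
  apply: le_trans (ler_normD _ _) _.
  by rewrite normrM (ger0_norm (sqr_ge0 _)) (ger0_norm (ler0n _ 2)); nra.
have := tay u; rewrite -/c; have u12 : `|u| <= 1 / 2 by lra.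
move=> /(_ u12); set r := _ - c * u ^+ 2 => rle.
have {}rle : `|r| <= C1 * 27 * normc e ^+ 3.
  apply: le_trans rle _; rewrite -mulrA ler_wpM2l//.
  have -> : 27 * normc e ^+ 3 = (3 * normc e) ^+ 3 by ring.
  by rewrite lerXn2r ?nnegrE// mulr_ge0.
have uE : u%:C = e + e^*%C + e * e^*%C.
  rewrite /u normc_sqr; clear; case: e => a b; apply/eqP; rewrite eq_complex/=.
  by apply/andP; split; apply/eqP => /=; ring.
have -> : ((normc (1 + e) ^+ 2) `^ q)%:C * (1 + e)^*%C - jet q e e^*%C =
    c%:C * ((e * e^*%C) * (2 * (e + e^*%C) + e * e^*%C)) + q%:C * (e * e^*%C * e^*%C)
    + c%:C * (u%:C * u%:C * e^*%C) + r%:C * (1 + e^*%C).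
  have -> : (normc (1 + e) ^+ 2) `^ q = 1 + q * u + c * u ^+ 2 + r.
    by rewrite u1 /r; ring.
  rewrite /jet -/c; clearbody c r u; rewrite !rmorphD !rmorph1 !rmorphM/= uE; ring.
have ej := normc_conj e.
have un : normc u%:C <= 3 * normc e by rewrite normc_real.
have e1 : normc (1 + e^*%C) <= 2 by apply: le_trans (ler_normcD _ _) _; rewrite ej normc1; lra.
have sn : normc (2 * (e + e^*%C) + e * e^*%C) <= 5 * normc e.
  apply: le_trans (ler_normcD _ _) _; rewrite !normcM ej.
  have -> : normc (2 : R[i]) = 2 by rewrite -[2 in LHS](rmorph_nat (real_complex R))
      normc_real normr_nat.
  have := ler_normcD e e^*%C; rewrite ej; nra.
have cube : normc e ^+ 3 = normc e * normc e * normc e by ring.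
have tri (z1 z2 z3 z4 : R[i]) :
    normc (z1 + z2 + z3 + z4) <= normc z1 + normc z2 + normc z3 + normc z4.
  apply: le_trans (ler_normcD _ _) _; rewrite lerD2r.
  by apply: le_trans (ler_normcD _ _) _; rewrite lerD2r ler_normcD.
apply: le_trans (tri _ _ _ _) _.
rewrite !normcM ej !normc_real cube.
have b1 : `|c| * (normc e * normc e * normc (2 * (e + e^*%C) + e * e^*%C)) <=
    `|c| * (normc e * normc e * (5 * normc e)).
  by rewrite !ler_wpM2l// mulr_ge0.
have b2 : `|c| * (`|u| * `|u| * normc e) <= `|c| * ((3 * normc e) * (3 * normc e) * normc e).
  by rewrite ler_wpM2l// ler_wpM2r// ler_pM.
have b3 : `|r| * normc (1 + e^*%C) <= C1 * 27 * normc e ^+ 3 * 2.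
  by apply: ler_pM => //; exact: normc_ge0.
rewrite cube in b3.
lra.
Qed.


(** The fourth roots of unity.  Averages over them annihilate w, w^2 and their
    conjugates, which is what the terms of degree at most 2 require. *)
Definition quarter : seq R[i] := [:: 1; -1; 'i%C; - 'i%C].

Lemma normc_quarter w : w \in quarter -> normc w = 1.
Proof.
by rewrite !inE => /or4P[] /eqP->; rewrite ?normcN /=
    ?expr0n ?sqrrN ?expr1n ?addr0 ?add0r sqrtr1.
Qed.

(** Averaging over w2: every monomial of the jet except 1 and e * conj e is
    multiplied by a nontrivial character. *)
Lemma sum_jet_quarter q b c :
  \sum_(w <- quarter) jet q (w * b) (w^*%C * c) = 4 * (1 + q%:C * (1 + q)%:C * (b * c)).
Proof.
have cN (z : R[i]) : (- z)^*%C = - z^*%C by exact: rmorphN.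
have ci : ('i%C : R[i])^*%C = - 'i%C by apply/eqP; rewrite eq_complex /= oppr0 !eqxx.
rewrite /quarter !big_cons big_nil !cN ci conjc1 /jet.
have : (q * (q - 1) / 2)%:C = q%:C * (q%:C - 1) / 2 :> R[i].
  by rewrite !rmorphM rmorphB fmorphV rmorph1 rmorph_nat.
move: (_ / 2)%:C => h hE.
have {}hE : q%:C ^+ 2 = 2 * h + q%:C :> R[i] by rewrite hE; field.
have -> : (1 + q)%:C = 1 + q%:C :> R[i] by rewrite rmorphD rmorph1.
have := @sqr_i R; set i := 'i%C => ii.

by ring: ii hE.
Qed.

(** Averaging over w1: the factor conj w1 selects, in the product
    (Z + conj w1) (Z' + w1), the cross term Z w1. *)
Lemma sum_conj_quarter q (d Z Z' : R[i]) :
  \sum_(w <- quarter) w^*%C * (4 * (1 + q%:C * (1 + q)%:C * (d * (Z + w^*%C) * (d * (Z' +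
      w))))) =
  16 * (q%:C * (1 + q)%:C * d ^+ 2 * Z).
Proof.
have cN (z : R[i]) : (- z)^*%C = - z^*%C by exact: rmorphN.
have ci : ('i%C : R[i])^*%C = - 'i%C by apply/eqP; rewrite eq_complex /= oppr0 !eqxx.
rewrite /quarter !big_cons big_nil !cN ci conjc1.
have := @sqr_i R; set i := 'i%C => ii.
by ring: ii.
Qed.

Definition perturbation (d : R) (Z w1 w2 : R[i]) : R[i] :=
  w2 * (d%:C * (Z + w1^*%C)).

(** The pointwise form of the averaged first variation.  The coefficient is
    16 p q (1 + q) with q = p/2 - 1, that is 4 p^2 (p - 2). *)
Lemma sum_normc_perturbation_le p : 1 <= p -> exists2 C : R, 0 <= C &
  forall (d : R) (Z y : R[i]), 0 <= d <= 1 / 16 -> normc Z = 1 ->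
  \sum_(w1 <- quarter) \sum_(w2 <- quarter)
    (normc (1 + perturbation d Z w1 w2 + w1^*%C * y) `^ p -
     normc (1 + perturbation d Z w1 w2) `^ p) <=
  4 * p ^+ 2 * (p - 2) * d ^+ 2 * complex.Re (Z * y) +
  C * (d ^+ 3 * normc y) + C * gauge p (normc y).
Proof.
move=> p1; have [C1 C10 bern] := normcD_powR_le p1.
have [C2 C20 jetle] := conj_powR_jet_le (p / 2 - 1).
exists (16 * C1 + 16 * (p * (C2 * 8))); first by rewrite !addr_ge0 ?mulr_ge0//; lra.
move=> d Z y /andP[d0 d16] Z1.
set q := p / 2 - 1 in jetle; pose e w1 w2 := perturbation d Z w1 w2.
have ele w1 w2 : w1 \in quarter -> w2 \in quarter -> normc (e w1 w2) <= 2 * d.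
  move=> q1 q2; rewrite /e /perturbation !normcM (normc_quarter q2) normc_real (ger0_norm
      d0) mul1r.
  rewrite mulrC ler_wpM2r//; apply: le_trans (ler_normcD _ _) _.
  by rewrite Z1 normc_conj (normc_quarter q1).
have step w1 w2 : w1 \in quarter -> w2 \in quarter ->
    normc (1 + e w1 w2 + w1^*%C * y) `^ p - normc (1 + e w1 w2) `^ p <=
    p * complex.Re (jet q (e w1 w2) (e w1 w2)^*%C * (w1^*%C * y)) +
    (p * (C2 * 8)) * (d ^+ 3 * normc y) + C1 * gauge p (normc y).
  move=> q1 q2; have := ele _ _ q1 q2; move: (e w1 w2) => v vd.
  have v8 : normc v <= 1 / 8 by lra.
  have vb : 1 / 2 <= normc (1 + v) <= 3 / 2.
    have h1 := ler_normcD 1 v; have h2 := ler_normcD (1 + v) (- v).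
    rewrite addrK normcN !normc1 in h1 h2; apply/andP; split; lra.
  have := bern _ (w1^*%C * y) vb.
  have wy : normc (w1^*%C * y) = normc y by rewrite normcM normc_conj (normc_quarter q1) mul1r.
  rewrite wy => {}bern.
  rewrite lerBlDl; apply: le_trans bern _; rewrite !addrA lerD2r -!addrA lerD2l.
  have -> : normc (1 + v) `^ (p - 2) = (normc (1 + v) ^+ 2) `^ q.
    rewrite -powR_mulrn ?normc_ge0// -powRrM; congr (_ `^ _); by rewrite /q; field.
  pose r := ((normc (1 + v) ^+ 2) `^ q)%:C * (1 + v)^*%C - jet q v v^*%C.
  have rle : normc r <= C2 * normc v ^+ 3 by exact: jetle.
  have E : ((normc (1 + v) ^+ 2) `^ q)%:C * (1 + v)^*%C =
      jet q v v^*%C + r by rewrite /r [RHS]addrC subrK.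
  have ReZ (a : R) (z : R[i]) : a * complex.Re z = complex.Re (a%:C * z).
    by case: z => ? ? /=; rewrite mul0r subr0.
  rewrite ReZ mulrA E mulrDl cReD mulrDr lerD2l -!mulrA ler_wpM2l//; first lra.
  apply: le_trans (ler_Re _) _; rewrite normcM wy.
  apply: le_trans (ler_wpM2r (normc_ge0 _) rle) _.
  have -> : C2 * (8 * (d * (d * (d * normc y)))) = C2 * (2 * d) ^+ 3 * normc y by ring.
  rewrite ler_wpM2r ?normc_ge0// ler_wpM2l//.
  by rewrite lerXn2r ?nnegrE ?normc_ge0 ?mulr_ge0.
pose K := (p * (C2 * 8)) * (d ^+ 3 * normc y) + C1 * gauge p (normc y).
apply: le_trans (_ : \sum_(w1 <- quarter) \sum_(w2 <- quarter)
    (p * complex.Re (jet q (e w1 w2) (e w1 w2)^*%C * (w1^*%C * y)) + K) <= _).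
  rewrite big_seq [leRHS]big_seq; apply: ler_sum => w1 q1.
  rewrite big_seq [leRHS]big_seq; apply: ler_sum => w2 q2.
  by rewrite /K addrA; exact: step.
under eq_bigr do rewrite big_split/= -mulr_sumr.
rewrite big_split/= -mulr_sumr.
have -> : \sum_(w1 <- quarter) \sum_(w2 <- quarter) K = 16 * K.
  by rewrite /quarter !big_cons !big_nil; ring.
have ReS (F : R[i] -> R[i]) : \sum_(w <- quarter) complex.Re (F w) =
    complex.Re (\sum_(w <- quarter) F w).
  by rewrite /quarter !big_cons !big_nil !cReD.
under eq_bigr do rewrite ReS.
rewrite ReS.
have -> : \sum_(w1 <- quarter) \sum_(w2 <- quarter) jet q (e w1 w2) (e w1 w2)^*%C * (w1^*%C
    * y)
    = 16 * (q%:C * (1 + q)%:C * d%:C ^+ 2 * Z) * y.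
  rewrite -(sum_conj_quarter q d%:C Z Z^*%C) mulr_suml; apply: eq_bigr => w1 _.
  rewrite -mulr_suml mulrCA mulrA; congr (_ * _ * _).
  rewrite -sum_jet_quarter.
  apply: eq_bigr => w2 _; congr (jet q _ _); rewrite /e /perturbation.
  have cM (z1 z2 : R[i]) : (z1 * z2)^*%C = z1^*%C * z2^*%C by exact: rmorphM.
  have cD (z1 z2 : R[i]) : (z1 + z2)^*%C = z1^*%C + z2^*%C by exact: rmorphD.
  by rewrite !cM cD conjcK conjc_real.
have -> : p * complex.Re (16 * (q%:C * (1 + q)%:C * d%:C ^+ 2 * Z) * y) =
   4 * p ^+ 2 * (p - 2) * d ^+ 2 * complex.Re (Z * y).
  have -> : 16 * (q%:C * (1 + q)%:C * d%:C ^+ 2 * Z) * y =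
      (16 * (q * (1 + q) * d ^+ 2))%:C * (Z * y).
    by rewrite !rmorphM rmorph_nat; ring.
  by rewrite cReM /= mul0r subr0 /q; field.
have g0 := gauge_ge0 p (normc y); have n0 := normc_ge0 y.
have dy0 : 0 <= d ^+ 3 * normc y by rewrite mulr_ge0 ?exprn_ge0.
have h1 : 0 <= C1 * (d ^+ 3 * normc y) by exact: mulr_ge0.
have h2 : 0 <= (p * (C2 * 8)) * gauge p (normc y) by rewrite !mulr_ge0//; lra.
rewrite /K; lra.
Qed.
End averaging.

(** * Integrable functions whose moments vanish *)

Section moments.
Context d (T : measurableType d) (R : realType) (mu : {measure set T -> \bar R}).
Variables X Y : T -> R.
Hypotheses (mX : measurable_fun setT X) (mY : measurable_fun setT Y).
Hypotheses (X1 : forall t, `|X t| <= 1) (Y1 : forall t, `|Y t| <= 1).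
Hypothesis XYgen : forall A : set T, measurable A ->
  exists2 B : set (R * R), measurable B & A = (fun t => (X t, Y t)) @^-1` B.
Implicit Types h m : T -> R.

Lemma integrable_bounded_mul m h K : measurable_fun setT m ->
  (forall t, `|m t| <= K) -> mu.-integrable setT (EFin \o h) ->
  mu.-integrable setT (EFin \o (fun t => m t * h t)).
Proof.
move=> mm mK ih.
have : mu.-integrable setT ((EFin \o m) \* (EFin \o h))%E.
  apply: integrableMr => //; exists K; split; first exact: num_real.
  by move=> L KL t _; exact: le_trans (mK t) (ltW KL).
by apply: eq_integrable.
Qed.

Let mono i j t := X t ^+ i * Y t ^+ j.

Let mono1 i j t : `|mono i j t| <= 1.
Proof.
by rewrite normrM !normrX -[1]mulr1 ler_pM ?exprn_ge0// exprn_ile1.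
Qed.

Let mmono i j : measurable_fun setT (mono i j).
Proof. by apply: measurable_funM; exact: measurable_funX. Qed.

Definition momentless h := mu.-integrable setT (EFin \o h) /\
  forall i j, \int[mu]_t (h t * (X t ^+ i * Y t ^+ j)) = 0.

(** Quantifying over all momentless h, rather than fixing one, makes the
    multipliers an algebra.  As it is also closed under bounded pointwise limits,
    the sets whose indicator it contains form a sigma-algebra. *)
Definition multiplier m := [/\ measurable_fun setT m,
  exists K, forall t, `|m t| <= K &
  forall h, momentless h -> momentless (fun t => m t * h t)].

Let imono h i j : mu.-integrable setT (EFin \o h) ->
  mu.-integrable setT (EFin \o (fun t => h t * mono i j t)).
Proof.
move=> ih; under eq_fun do rewrite mulrC.
exact: integrable_bounded_mul (mmono i j) (mono1 i j) ih.
Qed.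

Lemma multiplier_cst (c : R) : multiplier (fun=> c).
Proof.
split; first exact: measurable_cst.
  by exists `|c|.
move=> h [ih h0]; split.
  by apply: (@integrable_bounded_mul _ _ `|c|) => //; exact: measurable_cst.
move=> i j; under eq_Rintegral do rewrite -mulrA.
by rewrite RintegralZl ?h0 ?mulr0//; exact: imono.
Qed.

Lemma multiplierD m1 m2 : multiplier m1 -> multiplier m2 ->
  multiplier (fun t => m1 t + m2 t).
Proof.
move=> [mm1 [K1 mK1] m1h] [mm2 [K2 mK2] m2h]; split.
- exact: measurable_funD.
- by exists (K1 + K2) => t; apply: le_trans (ler_normD _ _) _; exact: lerD.
move=> h hh; have [i1 h1] := m1h _ hh; have [i2 h2] := m2h _ hh; split.
  under eq_fun do rewrite mulrDl.
  by have := integrableD measurableT i1 i2; apply: eq_integrable.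
move=> i j; under eq_Rintegral do rewrite mulrDl mulrDl.
by rewrite RintegralD ?h1 ?h2 ?addr0//; exact: imono.
Qed.

Lemma multiplierM m1 m2 : multiplier m1 -> multiplier m2 ->
  multiplier (fun t => m1 t * m2 t).
Proof.
move=> [mm1 [K1 mK1] m1h] [mm2 [K2 mK2] m2h]; split.
- exact: measurable_funM.
- exists (K1 * K2) => t; rewrite normrM; exact: ler_pM.
by move=> h /m2h/m1h; under eq_fun do rewrite mulrA.
Qed.

Lemma multiplierZ c m : multiplier m -> multiplier (fun t => c * m t).
Proof. exact: multiplierM (multiplier_cst c). Qed.

Lemma multiplierX : multiplier X.
Proof.
split => //; first by exists 1.
move=> h [ih h0]; split; first exact: integrable_bounded_mul ih.
move=> i j; rewrite -(h0 i.+1 j); apply: eq_Rintegral => t _.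
by rewrite exprS; ring.
Qed.

Lemma multiplierY : multiplier Y.
Proof.
split => //; first by exists 1.
move=> h [ih h0]; split; first exact: integrable_bounded_mul ih.
move=> i j; rewrite -(h0 i j.+1); apply: eq_Rintegral => t _.
by rewrite exprS; ring.
Qed.

Lemma multiplier_cvg (m_ : nat -> T -> R) m K :
  (forall n, multiplier (m_ n)) -> (forall n t, `|m_ n t| <= K) ->
  (forall t, m_ ^~ t @ \oo --> m t) -> multiplier m.
Proof.
move=> mm_ mK m_m.
have mm : measurable_fun setT m.
  by apply: (measurable_fun_cvg (h := m_)) => [n|t _]; [have [] := mm_ n|exact: m_m].
have mK' t : `|m t| <= K.
  by apply: (cvgr_to_le (cvg_norm (m_m t))); exact: nearW.
split => //; first by exists K.
move=> h hh; have [ih h0] := hh; split; first exact: integrable_bounded_mul ih.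
move=> i j.
have ih' := imono i j ih.
have ig : mu.-integrable setT (EFin \o (fun t => K * `|h t * mono i j t|)).
  apply: (@integrable_bounded_mul (fun=> K) _ `|K|) => //.
  exact: integrable_norm ih'.
have mh : measurable_fun setT h by apply/measurable_EFinP; exact: measurable_int ih.
have mmh n : measurable_fun setT (EFin \o (fun t => m_ n t * h t * mono i j t)).
  apply/measurable_EFinP; apply: measurable_funM => //; apply: measurable_funM => //.
  by have [] := mm_ n.
have mmh' : measurable_fun setT (EFin \o (fun t => m t * h t * mono i j t)).
  by apply/measurable_EFinP; apply: measurable_funM => //; apply: measurable_funM.
have [||_ _ +] := dominated_convergence measurableT mmh mmh' _ ig _.
- apply/nearW => t _ /=; apply/fine_cvgP; split; first exact: nearW.
  by apply: cvgMl; apply: cvgMl; exact: m_m.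
- apply/nearW => t n _ /=; rewrite lee_fin -mulrA normrM ler_wpM2r//.
rewrite (_ : [sequence _]_n = fun=> 0%E); last first.
  apply/funext => n /=; have [_ _ mnh] := mm_ n.
  have [ih1 h1] := mnh _ hh; have E := h1 i j.
  rewrite -[LHS]fineK; first exact: (congr1 EFin E).
  by have := integrable_fin_num measurableT (imono i j ih1).
move=> lim0; have := cvg_lim (@ereal_hausdorff R) lim0.
rewrite lim_cst; last exact: ereal_hausdorff.
by rewrite /Rintegral => E; rewrite -[X in fine X]E.
Qed.

Lemma multiplier_sum (m_ : nat -> T -> R) n : (forall k, multiplier (m_ k)) ->
  multiplier (fun t => \sum_(0 <= k < n) m_ k t).
Proof.
move=> mm; elim: n => [|n ih].
  by under eq_fun do rewrite big_geq//; exact: multiplier_cst.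
by under eq_fun do rewrite big_nat_recr//=; exact: multiplierD.
Qed.

Lemma multiplierXn m n : multiplier m -> multiplier (fun t => m t ^+ n).
Proof.
move=> mm; elim: n => [|n ih]; first exact: multiplier_cst.
by under eq_fun do rewrite exprS; exact: multiplierM.
Qed.

(** The partial sums of the exponential series at m are bounded by exp K. *)
Lemma multiplier_expR m : multiplier m -> multiplier (fun t => expR (m t)).
Proof.
move=> mm; have [_ [K mK] _] := mm.
apply: (@multiplier_cvg (fun n t => series (exp_coeff (m t)) n) _ (expR K)).
- have mk k : multiplier (fun t => m t ^+ k / k`!%:R).
    by under eq_fun do rewrite mulrC; exact/multiplierZ/multiplierXn.
  by move=> n; exact: multiplier_sum n mk.
- move=> n t; have K0 : 0 <= K := le_trans (normr_ge0 _) (mK t).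
  apply: (@le_trans _ _ (series (exp_coeff K) n)); last first.
    apply: nondecreasing_cvgn_le; last exact: is_cvg_series_exp_coeff.
    by apply: nondecreasing_series => k _ _; exact: exp_coeff_ge0.
  rewrite /series/=; apply: le_trans (ler_norm_sum _ _ _) _; apply: ler_sum => k _.
  rewrite /exp_coeff normrM normrX (ger0_norm (_ : 0 <= k`!%:R^-1)) ?invr_ge0//.
  by rewrite ler_wpM2r ?invr_ge0// lerXn2r ?nnegrE.
- move=> t; exact: is_cvg_series_exp_coeff.
Qed.

(** A step function as a limit of functions built with exp alone: this is what
    replaces polynomial approximation.  The factor n in front of the inner
    exponential sends the value at c = 0 to 0. *)
Lemma cvg_expR_expR (c : R) :
  (fun n : nat => expR (- (n%:R * expR (n%:R * c)))) @ \oo --> (if c < 0 then 1 else 0 : R).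
Proof.
case: ifPn => [c0|]; last rewrite -leNgt => c0.
  have n0 : (fun n : nat => n%:R * expR (n%:R * c) : R) @ \oo --> (0 : R).
    apply: (@squeeze_cvgr _ _ _ _ (fun=> 0) (fun n => 8 / c ^+ 2 * n.+1%:R^-1)).
    - apply: nearW => -[|n]; rewrite ?mul0r.
        by rewrite lexx /= mulr_ge0 ?divr_ge0// ?sqr_ge0.
      rewrite mulr_ge0 ?expR_ge0//=.
      set N : R := n.+1%:R; have N1 : 1 <= N by rewrite /N ler1n.
      have -> : n.+2%:R = N + 1 by rewrite -natr1.
      clearbody N.
      have h : N * - c / 2 <= expR (N * - c / 2).
        by apply: le_trans (expR_ge1Dx _); rewrite lerDr.
      have E : expR (N * - c) = expR (N * - c / 2) ^+ 2.
        by rewrite expr2 -expRD; congr expR; field.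
      have h2 : (N * - c / 2) ^+ 2 <= expR (N * - c).
        by rewrite E lerXn2r ?nnegrE ?expR_ge0//; nra.
      have -> : N * c = - (N * - c) by ring.
      rewrite expRN ler_pdivrMr ?expR_gt0//.
      apply: le_trans (ler_wpM2l _ h2).
        have -> : 8 / c ^+ 2 / (N + 1) * (N * - c / 2) ^+ 2 = N * (2 * N / (N + 1)).
          by field; rewrite (lt_eqF c0) gt_eqF//; lra.
        by rewrite ler_peMr ?ler_pdivlMr; lra.
      by rewrite !divr_ge0 ?sqr_ge0//; lra.
    - exact: cvg_cst.
    - rewrite -[X in _ --> X](mulr0 (8 / c ^+ 2)); apply: cvgMr; exact: cvg_harmonic.
  rewrite -[X in _ --> X]expR0; apply: continuous_cvg; first exact: continuous_expR.
  by rewrite -[X in _ --> X]oppr0; apply: cvgN.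
apply: (@squeeze_cvgr _ _ _ _ (fun=> 0) harmonic); [|exact: cvg_cst|exact: cvg_harmonic].
apply: nearW => n; rewrite expR_ge0/= expRN /harmonic/= lef_pV2 ?posrE ?expR_gt0//.
apply: le_trans (expR_ge1Dx _); rewrite -natr1 addrC lerD2l.
rewrite -[leLHS]mulr1 ler_wpM2l// -expR0 ler_expR mulr_ge0//.
Qed.

Lemma multiplier_gt m (s : R) : multiplier m -> multiplier (fun t => ((s < m t)%R)%:R).
Proof.
move=> mm.
apply: (@multiplier_cvg (fun n t => expR (- (n%:R * expR (n%:R * (s - m t))))) _ 1).
- move=> n; apply: multiplier_expR; under eq_fun do rewrite -mulN1r mulrA.
  apply/multiplierZ/multiplier_expR/multiplierZ/multiplierD; first exact: multiplier_cst.
  by under eq_fun do rewrite -mulN1r; exact: multiplierZ.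
- move=> n t; rewrite ger0_norm ?expR_ge0//.
- move=> t; have := @cvg_expR_expR (s - m t); rewrite subr_lt0.
  by case: ifP.
Qed.

Definition multiplier_set (B : set T) := multiplier (fun t => (t \in B)%:R).

(** Countable unions: the indicators of the finite intersections of complements
    are products of multipliers, and converge boundedly. *)
Lemma multiplier_set_sigma_algebra : sigma_algebra setT multiplier_set.
Proof.
split.
- rewrite /multiplier_set; under eq_fun do rewrite in_set0; exact: multiplier_cst.
- move=> A mA; rewrite /multiplier_set.
  have E t : (t \in setT `\` A)%:R = 1 + -1 * (t \in A)%:R :> R.
    by rewrite in_setD in_setT/=; case: (t \in A) => /=; ring.
  by under eq_fun do rewrite E; apply: multiplierD; [exact: multiplier_cst|exact: multiplierZ].
move=> A mA; rewrite /multiplier_set.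
have E t : (t \in \bigcup_k A k)%:R = 1 + -1 * (t \notin \bigcup_k A k)%:R :> R.
  by case: (t \in _) => /=; ring.
under eq_fun do rewrite E; apply: multiplierD; first exact: multiplier_cst.
apply: multiplierZ.
pose p n t : R := \prod_(0 <= k < n) (1 + -1 * (t \in A k)%:R).
have pE n t : p n t = [forall k : 'I_n, t \notin A k]%:R.
  rewrite /p big_mkord; case: (boolP [forall k, _]) => [/forallP h|].
    by rewrite big1// => k _; rewrite (negbTE (h k)) mulr0 addr0.
  rewrite negb_forall => /existsP[k /negPn tk]; rewrite (bigD1 k)//= tk/=.
  by rewrite mulN1r subrr mul0r.
apply: (@multiplier_cvg p _ 1).
- rewrite /p => n; elim: n => [|n ih].
    by under eq_fun do rewrite big_geq//; exact: multiplier_cst.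
  under eq_fun do rewrite big_nat_recr//=; apply: multiplierM ih _.
  by apply: multiplierD; [exact: multiplier_cst|exact: multiplierZ (mA n)].
- by move=> n t; rewrite pE normr_nat lern1 leq_b1.
- move=> t; apply: (cvg_near_cst).
  have [|tA] := boolP (t \in \bigcup_k A k).
    move=> /set_mem[k _ Akt]; exists k.+1 => // n /= kn; rewrite pE.
    case: (boolP [forall _, _]) => // /forallP /(_ (Ordinal kn))/=.
    by rewrite mem_set.
  near=> n; rewrite pE; case: (boolP [forall _, _]) => //.
  rewrite negb_forall => /existsP[k /negPn/set_mem tk]; case/negP: tA.
  by apply/mem_set; exists k.
Unshelve. all: by end_near. Qed.

Lemma multiplier_setT_measurable (A : set T) : measurable A -> multiplier_set A.
Proof.
move=> /XYgen[B mB ->].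
have sa := sigma_algebra_image (fun t => (X t, Y t)) multiplier_set_sigma_algebra.
have ray (Z : T -> R) : multiplier Z -> forall C : set R,
    measurable C -> multiplier_set (Z @^-1` C).
  move=> mZ C; rewrite [measurable _](_ : _ = (@RGenOInfty.G R).-sigma.-measurable C);
      last first.
    by rewrite -RGenOInfty.measurableE.
  have saZ := sigma_algebra_image Z multiplier_set_sigma_algebra.
  suff h : <<s @RGenOInfty.G R >> `<=` image_set_system setT Z multiplier_set.
    by move=> /h; rewrite /image_set_system/= setTI.
  apply: smallest_sub => // _ [s ->]; rewrite /image_set_system/= setTI /multiplier_set.
  have E t : (t \in Z @^-1` `]s, +oo[)%:R = ((s < Z t)%R)%:R :> R.
    congr (_%:R); congr nat_of_bool; apply/idP/idP => [/set_mem|sZ].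
      by rewrite /= in_itv/= andbT.
    by apply/mem_set; rewrite /= in_itv/= andbT.
  by under eq_fun do rewrite E; exact: multiplier_gt.
suff h : measurable `<=` image_set_system setT (fun t => (X t, Y t)) multiplier_set.
  by have := h _ mB; rewrite /image_set_system/= setTI.
apply: smallest_sub => // C [[D mD <-]|[D mD <-]]; rewrite /image_set_system/= !setTI.
- exact: ray multiplierX _ mD.
- exact: ray multiplierY _ mD.
Qed.

(** The sign of h is a multiplier, so the integral of |h| vanishes. *)
Lemma momentless_ae0 h : momentless h -> h = 0 %[ae mu].
Proof.
move=> hh; have [ih _] := hh.
have mh : measurable_fun setT h by apply/measurable_EFinP; exact: measurable_int ih.
have mB : measurable [set t | 0 < h t].
  have := mh measurableT `]0, +oo[%classic (measurable_itv _).
  rewrite setTI; congr measurable; apply/seteqP; split => t /=; by rewrite in_itv/= andbT.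
(* This multiplier is the sign of h, up to its value on the zeros of h. *)
have [_ _ mhh] : multiplier (fun t => -1 + 2 * (t \in [set t | 0 < h t])%:R).
  apply: multiplierD; first exact: multiplier_cst.
  exact/multiplierZ/multiplier_setT_measurable.
have [_ m0] := mhh _ hh; have := m0 0%N 0%N; under eq_Rintegral.
  move=> t _; rewrite !expr0 !mulr1.
  have -> : (-1 + 2 * (t \in [set t | 0 < h t])%:R) * h t = `|h t|.
    have [t0|t0] := boolP (0 < h t).
      by rewrite mem_set// gtr0_norm// mulr1; ring.
    rewrite memNset/=; last exact/negP.
    by rewrite ler0_norm ?leNgt// mulr0 addr0 mulN1r.
  over.
move=> E0; have E : (\int[mu]_t (`|h t|)%:E = 0)%E.
  rewrite -[LHS]fineK; first exact: (congr1 EFin E0).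
  by have := integrable_fin_num measurableT (integrable_norm ih).
 have /(ae_eq_integral_abs mu measurableT (measurable_int mu ih)) :
     (\int[mu]_t `|(EFin \o h) t| = 0)%E.
  by rewrite -E; apply: eq_integral.
by apply: filterS => t /(_ I)/= [ht] _.
Qed.

End moments.

(** * Fourier coefficients on the circle *)

Section circle_integrals.
Context {R : realType}.
Local Notation mu := (circle_measure R).
Implicit Types (z : circle R) (n : int) (k : nat).

Lemma circle_val_cisX (t : R) k :
  circle_val (cis t) ^+ k = cos (k%:R * t) +i* sin (k%:R * t).
Proof.
elim: k => [|k ih]; first by rewrite expr0 mul0r cos0 sin0.
rewrite exprS ih -natr1 mulrDl mul1r addrC cosD sinD.
by apply/eqP; rewrite eq_complex/=; apply/andP; split; apply/eqP; ring.
Qed.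

Lemma ge0_integral_circle (f : circle R -> R) : measurable_fun setT f ->
  (forall z, 0 <= f z) ->
  (\int[mu]_z (f z)%:E = ((2 * pi)^-1)%R%:E *
    \int[lebesgue_measure]_(t in `[0%R, (2 * pi)%R]) (f (cis t))%:E)%E.
Proof.
move=> mf f0.
rewrite ge0_integral_distribution//; last exact/measurable_EFinP.
rewrite integral_uniform ?subr0//.
  by apply/measurable_EFinP; apply: measurableT_comp => //; exact: measurable_cis.
by move=> t; rewrite /= lee_fin.
Qed.

(** The fundamental theorem of calculus on [0, 2 pi], applied to 1 + f: this
    function is nonnegative and its integral is found to be 1. *)
Lemma circle_integral_eq0 (f : circle R -> R) (g G : R -> R) :
  measurable_fun setT f -> (forall z, `|f z| <= 1) ->
  (forall t, f (cis t) = g t) -> continuous g ->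
  (forall t : R, is_derive t (1 : R) G (g t)) -> G (2 * pi) = G 0 ->
  \int[mu]_z f z = 0.
Proof.
move=> mf f1 fg cg dG G0.
have if1 : mu.-integrable setT (EFin \o f).
  apply: (@le_integrable _ _ _ mu setT measurableT _ (cst 1%E)) => //.
  - exact/measurable_EFinP.
  - by move=> z _ /=; rewrite lee_fin normr1.
  - exact: finite_measure_integrable_cst.
have ic : mu.-integrable setT (EFin \o cst 1%R) by exact: finite_measure_integrable_cst.
suff : \int[mu]_z (1 + f z) = 1.
  rewrite RintegralD// Rintegral_cst// mul1r.
  rewrite [X in fine X + _](_ : _ = 1%E); last exact: probability_setT.
  move=> /= /eqP.
  by rewrite -subr_eq0 addrAC subrr add0r => /eqP.
rewrite /Rintegral ge0_integral_circle; last 2 first.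
- by apply: measurable_funD => //.
- by move=> z; have := f1 z; rewrite ler_norml => /andP[h _]; rewrite -lerBlDl sub0r.
have cF (t : R) : {for t, continuous (fun t => t + G t)}.
  apply: differentiable_continuous; apply/derivable1_diffP.
  by apply: derivableD => //; have [] := dG t.
rewrite (@continuous_FTC2 _ _ (fun t => t + G t)).
- rewrite G0 /= opprD addrACA subrr addr0 subr0 mulVf// gt_eqF//; exact: pi2_gt0.
- exact: pi2_gt0.
- apply: continuous_subspaceT => t; under eq_fun do rewrite fg.
  by apply: cvgD; [exact: cvg_cst|exact: cg].
- split.
  + by move=> t _; apply: derivableD => //; have [] := dG t.
  + by apply: cvg_at_right_filter; exact: cF.
  + by apply: cvg_at_left_filter; exact: cF.
- move=> t _; rewrite derive1E fg; have dtG := dG t.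
  by have [_ <-] := is_deriveD (is_derive_id t (1 : R)) dtG.
Qed.

Lemma cintegral_circle_valX n : cintegral mu (fun z => circle_val z ^ n) = (n == 0)%:R.
Proof.
have [->|n0] := eqVneq n 0.
  rewrite (_ : (fun z => _) = fun=> 1)// /cintegral /=.
  rewrite !Rintegral_cst//= mul0r mul1r.
  by rewrite [X in fine X](_ : _ = 1%E)//; exact: probability_setT.
have cmX m := cmeasurable_circle_valX (R := R) m.
have cos_sin k : (0 < k)%N ->
    \int[mu]_z (complex.Re (circle_val z ^+ k)) = 0 /\ \int[mu]_z (complex.Im (circle_val z
        ^+ k)) = 0.
  move=> k0; have kR : k%:R != 0 :> R by rewrite pnatr_eq0 -lt0n.
  have [mr mi] := cmX k%:Z.
  have per : k%:R * (2 * pi) = 0 + (pi *+ 2) *+ k :> R.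
    by rewrite add0r -mulr_natl [pi *+ 2]mulr2n; ring.
  have ck : continuous (fun t : R => k%:R * t) by move=> t; apply: cvgMr.
  have dk (t : R) : is_derive t 1 (fun t : R => k%:R * t) k%:R.
    have := is_deriveZ k%:R (is_derive_id t (1 : R)); rewrite /GRing.scale/= mulr1; exact.
  split.
  - apply: (@circle_integral_eq0 _ (fun t => cos (k%:R * t)) (fun t =>
      sin (k%:R * t) / k%:R)) => //.
    + move=> z; apply: le_trans (ler_Re_normc _) _; by rewrite (normc_circle_valX z k).
    + by move=> t; rewrite circle_val_cisX.
    + move=> t; apply: (@continuous_comp _ _ _ (fun t : R => k%:R * t) cos); [exact:
        ck|exact: continuous_cos].
    + move=> t; have := is_derive1_comp (is_derive_sin (k%:R * t)) (dk t).
      move=> h; have := is_deriveZ (k%:R^-1) h; rewrite /GRing.scale/= mulrC mulfK//.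
      by congr is_derive; apply/funext => u; rewrite [RHS]mulrC.
    + by rewrite per (periodicn (_ : periodic sin (pi *+ 2))) ?mulr0 ?sin0 ?mul0r//;
        move=> u; rewrite sinD cos2pi sin2pi mulr1 mulr0 addr0.
  - apply: (@circle_integral_eq0 _ (fun t => sin (k%:R * t)) (fun t =>
      - cos (k%:R * t) / k%:R)) => //.
    + move=> z; apply: le_trans (ler_Im_normc _) _; by rewrite (normc_circle_valX z k).
    + by move=> t; rewrite circle_val_cisX.
    + move=> t; apply: (@continuous_comp _ _ _ (fun t : R => k%:R * t) sin); [exact:
        ck|exact: continuous_sin].
    + move=> t; have := is_derive1_comp (is_derive_cos (k%:R * t)) (dk t).
      move=> h; have := is_deriveZ (- k%:R^-1) h; rewrite /GRing.scale/=
          mulNr mulrC mulfK// opprK.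
      by congr is_derive; apply/funext => u; rewrite [RHS]mulrC [RHS]mulrN -[RHS]mulNr.
    + by rewrite per (periodicn (_ : periodic cos (pi *+ 2))) ?mulr0//; move=> u;
        rewrite cosD cos2pi sin2pi mulr1 mulr0 subr0.
have conjX k z : circle_val z ^ Negz k = (circle_val z ^+ k.+1)^*%C.
  have -> : Negz k = - k.+1%:Z by [].
  by rewrite -invr_expz invc_norm -Defs.normcE normc_circle_valX expr1n invr1 mul1r.
case: n n0 => k k0.
  have [|cs sn] := cos_sin k; first by rewrite lt0n; exact: k0.
  by rewrite /cintegral [X in X +i* _]cs [X in _ +i* X]sn.
have [|cs sn] := cos_sin k.+1; first by [].
rewrite /cintegral.
have -> : \int[mu]_z complex.Re (circle_val z ^ Negz k) = 0.
  by rewrite -[RHS]cs; apply: eq_Rintegral => z _; rewrite conjX; case: (_ ^+ _).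
suff -> : \int[mu]_z complex.Im (circle_val z ^ Negz k) = 0 by [].
have imX : mu.-integrable setT (EFin \o (fun z => complex.Im (circle_val z ^+ k.+1))).
  have [mr mi] := cmX k.+1%:Z.
  apply: (@le_integrable _ _ _ mu setT measurableT _ (cst 1%E)) => //.
  - exact/measurable_EFinP.
  - move=> z _ /=; rewrite lee_fin normr1.
    by apply: le_trans (ler_Im_normc _) _; rewrite (normc_circle_valX z k.+1).
  - exact: finite_measure_integrable_cst.
rewrite -[RHS](mulr0 (-1)) -[in RHS]sn -RintegralZl//.
by apply: eq_Rintegral => z _; rewrite conjX mulN1r; case: (_ ^+ _).
Qed.

Lemma circle_valXN z n : circle_val z ^ (- n) = (circle_val z ^ n)^*%C.
Proof.
by rewrite -invr_expz invc_norm -Defs.normcE normc_circle_valX expr1n invr1 mul1r.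
Qed.

Lemma circle_val_neq0 z : circle_val z != 0.
Proof. by rewrite -normr_eq0 -Defs.normcE normc_circle_val oner_eq0. Qed.

Lemma fourier_coef_valX (k n : int) :
  fourier_coef (fun z => circle_val z ^ k) n = (k == n)%:R.
Proof.
rewrite /fourier_coef (_ : (fun z => _) = fun z => circle_val z ^ (k - n)).
  by rewrite cintegral_circle_valX subr_eq0.
by apply/funext => z; rewrite -expfzDr// circle_val_neq0.
Qed.

Lemma cintegrable_bounded_mul (f m : circle R -> R[i]) K : cintegrable mu f ->
  cmeasurable m -> (forall z, normc (m z) <= K) ->
  cintegrable mu (fun z => f z * m z).
Proof.
move=> [fr fi] [mr mi] mK.
have rK z : `|complex.Re (m z)| <= K by exact: le_trans (ler_Re_normc _) (mK z).
have iK z : `|complex.Im (m z)| <= K by exact: le_trans (ler_Im_normc _) (mK z).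
split; under eq_fun do rewrite ?cReM ?cImM.
- under eq_fun do rewrite [_ * complex.Re (m _)]mulrC [_ * complex.Im (m _)]mulrC.
  have := integrableB measurableT (integrable_bounded_mul mr rK fr) (integrable_bounded_mul
      mi iK fi).
  by apply: eq_integrable.
- under eq_fun do rewrite [_ * complex.Re (m _)]mulrC [_ * complex.Im (m _)]mulrC.
  have := integrableD measurableT (integrable_bounded_mul mi iK fr) (integrable_bounded_mul
      mr rK fi).
  by apply: eq_integrable.
Qed.

Let X z := complex.Re (circle_val z).
Let Y z := complex.Im (circle_val z).

(** The real and imaginary parts of z are combinations of z and 1/z, so each
    moment of f is a combination of Fourier coefficients of f. *)
Lemma fourier_coef_moment (f : circle R -> R[i]) : cintegrable mu f ->
  (forall n, fourier_coef f n = 0) -> forall i j,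
  cintegral mu (fun z => f z * ((X z)%:C ^+ i * (Y z)%:C ^+ j)) = 0.
Proof.
move=> fi f0 i j.
have XE z : (X z)%:C = 2^-1 * (circle_val z ^ 1 + circle_val z ^ (-1)).
  rewrite circle_valXN expr1z /X; case: (circle_val z) => a b; apply/eqP.
  rewrite -[2](rmorph_nat (real_complex R)) -fmorphV eq_complex/=.
  by apply/andP; split; apply/eqP; field.
have YE z : (Y z)%:C = (- 'i%C / 2) * circle_val z ^ 1 + ('i%C / 2) * circle_val z ^ (-1).
  rewrite circle_valXN expr1z /Y; case: (circle_val z) => a b; apply/eqP.
  rewrite -[2](rmorph_nat (real_complex R)) -fmorphV eq_complex/=.
  by apply/andP; split; apply/eqP; field.
have cmR (g : circle R -> R) : measurable_fun setT g -> cmeasurable (fun z => (g z)%:C).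
  by move=> mg; split => //; exact: measurable_cst.
have [mX mY] : cmeasurable (@circle_val R).
  by have := cmeasurable_circle_valX (R := R) 1; under eq_fun do rewrite expr1z.
have cmXn (g : circle R -> R[i]) k : cmeasurable g -> cmeasurable (fun z => g z ^+ k).
  move=> cg; elim: k => [|k ih]; first by split; exact: measurable_cst.
  by under eq_fun do rewrite exprS; exact: cmeasurableM.
pose m n i j z := circle_val z ^ n * ((X z)%:C ^+ i * (Y z)%:C ^+ j).
have m1 n i' j' z : normc (m n i' j' z) <= 1.
  rewrite !normcM normc_circle_valX mul1r.
  have nX k w : normc (w ^+ k) = normc w ^+ k.
    by elim: k => [|k ih]; rewrite ?expr0 ?normc1// !exprS normcM ih.
  rewrite !nX mulr_ile1 ?exprn_ge0 ?normc_ge0//; apply: exprn_ile1; rewrite ?normc_ge0//=.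
  - by rewrite expr0n addr0 sqrtr_sqr -(normc_circle_val z) ler_Re_normc.
  - by rewrite expr0n addr0 sqrtr_sqr -(normc_circle_val z) ler_Im_normc.
have cm n i' j' : cmeasurable (m n i' j').
  apply: cmeasurableM; first exact: cmeasurable_circle_valX.
  by apply: cmeasurableM; apply: cmXn; exact: cmR.
have im n i' j' : cintegrable mu (fun z => f z * m n i' j' z).
  exact: cintegrable_bounded_mul fi (cm _ _ _) (m1 _ _ _).
have lin (a b : R[i]) n1 n2 i' j' : (forall n, cintegral mu (fun z => f z * m n i' j' z) =
    0) ->
    cintegral mu (a *: (fun z => f z * m n1 i' j' z) + b *: (fun z => f z * m n2 i' j' z)) = 0.
  move=> h; have iZ (c : R[i]) n : cintegrable mu (c *: (fun z => f z * m n i' j' z)).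
    have mc : cmeasurable ((fun=> c) : circle R -> R[i]) by split; exact: measurable_cst.
    have := cintegrable_bounded_mul (im n i' j') mc (fun=> lexx (normc c)).
    by under eq_fun do rewrite mulrC.
  by rewrite cintegralD// !cintegralZ// !h !mulr0 addr0.
suff h n : cintegral mu (fun z => f z * m n i j z) = 0.
  by rewrite -(h 0); congr cintegral; apply/funext => z; rewrite /m expr0z mul1r.
elim: i n => [|i ihi] n; last first.
  rewrite -(lin 2^-1 2^-1 (n + 1) (n - 1) i j ihi); congr cintegral.
  apply/funext => z; rewrite !fctE /GRing.scale/= /m exprS {1}XE !expfzDr
      ?circle_val_neq0//; ring.
elim: j n => [|j ihj] n; last first.
  rewrite -(lin (- 'i%C / 2) ('i%C / 2) (n + 1) (n - 1) 0%N j ihj); congr cintegral.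
  apply/funext => z; rewrite !fctE /GRing.scale/= /m [_ ^+ j.+1]exprS {1}YE !expfzDr
      ?circle_val_neq0//; ring.
rewrite -(f0 (- n)); congr cintegral; apply/funext => z.
by rewrite /m opprK !expr0 !mulr1.
Qed.

(** The Borel sets of the circle are generated by the real and the imaginary part
    of z, so the moment problem applies to the two parts of f. *)
Lemma fourier_uniqueness (f : circle R -> R[i]) : cintegrable mu f ->
  (forall n, fourier_coef f n = 0) -> f = 0 %[ae mu].
Proof.
move=> fi f0; have mom := fourier_coef_moment fi f0.
have [mX mY] : cmeasurable (@circle_val R).
  by have := cmeasurable_circle_valX (R := R) 1; under eq_fun do rewrite expr1z.
have X1 z : `|X z| <= 1 by rewrite -(normc_circle_val z) ler_Re_normc.
have Y1 z : `|Y z| <= 1 by rewrite -(normc_circle_val z) ler_Im_normc.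
have gen (A : set (circle R)) : measurable A ->
    exists2 B : set (R * R), measurable B & A = (fun t => (X t, Y t)) @^-1` B.
  by move=> [B mB <-]; exists B => //; rewrite setTI.
have ReIm i j : \int[mu]_z (complex.Re (f z) * (X z ^+ i * Y z ^+ j)) = 0 /\
    \int[mu]_z (complex.Im (f z) * (X z ^+ i * Y z ^+ j)) = 0.
  have := mom i j.
  have E z : (X z)%:C ^+ i * (Y z)%:C ^+ j = (X z ^+ i * Y z ^+ j)%:C.
    by rewrite rmorphM !rmorphXn.
  under eq_fun do rewrite E.
  rewrite /cintegral => /eqP; rewrite eq_complex/= => /andP[/eqP h1 /eqP h2].
  split; [rewrite -[RHS]h1|rewrite -[RHS]h2]; apply: eq_Rintegral => z _.
    by rewrite cReM/= mulr0 subr0.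
  by rewrite cImM/= mulr0 add0r.
have reE : (fun z => complex.Re (f z)) = 0 %[ae mu].
  apply: (momentless_ae0 mX mY X1 Y1 gen); split; first by case: fi.
  by move=> i j; have [] := ReIm i j.
have imE : (fun z => complex.Im (f z)) = 0 %[ae mu].
  apply: (momentless_ae0 mX mY X1 Y1 gen); split; first by case: fi.
  by move=> i j; have [] := ReIm i j.
apply: filterS2 reE imE => z /(_ I) re /(_ I) im _.
by apply/eqP; rewrite eq_complex; apply/andP; split; apply/eqP.
Qed.

End circle_integrals.

(** * Elements of the Hardy space as functions *)

Section Hp_functions.
Variables (R : realType) (p : R) (p1 : 1 <= p).
Local Notation mu := (circle_measure R).
Implicit Types (x y : Hp p1) (f g : circle R -> R[i]).

Let p0 : 0 < p := lt_le_trans ltr01 p1.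

(** Vectors are classes of functions; this relation lets sums and multiples be
    computed pointwise, on any convenient representative. *)
Definition represents x f :=
  cmeasurable f /\ (Lp_repr (Hp_val x) : circle R -> R[i]) = f %[ae mu].

Definition energy f := \int[mu]_z (normc (f z) `^ p).

Lemma represents_repr x : represents x (Lp_repr (Hp_val x)).
Proof. by split; [exact: LpFun_cmeasurable|exact: ae_eq_refl]. Qed.

Lemma representsD x y f g : represents x f -> represents y g ->
  represents (x + y) (fun z => f z + g z).
Proof.
move=> [mf xf] [mg yg]; split; first exact: cmeasurableD mf mg.
have xy := Lp_classK (Lp_repr (Hp_val x) + Lp_repr (Hp_val y)).
apply: filterS3 xy xf yg => z /= + + + _ => /(_ I) xyz /(_ I) <- /(_ I) <-.
exact: xyz.
Qed.

Lemma representsZ a x f : represents x f -> represents (a *: x) (fun z => a * f z).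
Proof.
move=> [mf xf]; split.
  by apply: (cmeasurableM (f := fun=> a)) mf; split; exact: measurable_cst.
have ax := Lp_classK (a *: Lp_repr (Hp_val x)).
apply: filterS2 ax xf => z /= + + _ => /(_ I) axz /(_ I) <-.
exact: axz.
Qed.

Lemma represents0 : represents 0 (fun=> 0).
Proof.
by have := representsZ 0 (represents_repr 0); rewrite scale0r; under eq_fun do rewrite mul0r.
Qed.

Lemma represents_norm x f : represents x f -> `|x| = (fine (cLnorm mu p f))%:C.
Proof.
move=> [mf xf]; rewrite Hp_normE Lp_normrE /Lp_norm; congr (fine _)%:C.
by apply: cLnorm_ae_eq xf => //; exact: LpFun_cmeasurable.
Qed.

Lemma represents_lty x f : represents x f -> (cLnorm mu p f < +oo)%E.
Proof.
move=> [mf xf]; have := LpFun_lty (Lp_repr (Hp_val x)).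
by rewrite (cLnorm_ae_eq p _ mf xf)//; exact: LpFun_cmeasurable.
Qed.

Lemma represents_cLfun x f : represents x f -> f \in cLfun mu p.
Proof. by move=> xf; apply/cLfunP; split; [case: xf|exact: represents_lty xf]. Qed.

Lemma represents_integrable_powR x f : represents x f ->
  mu.-integrable setT (EFin \o (fun z => normc (f z) `^ p)).
Proof.
move=> xf; have [mf _] := xf.
have mp : measurable_fun setT (fun z => normc (f z) `^ p).
  apply: (@measurableT_comp _ _ _ _ _ _ (@powR R ^~ p)) => //.
  exact: cmeasurable_normc.
apply/integrableP; split; first exact/measurable_EFinP.
under eq_integral do rewrite /= ger0_norm ?powR_ge0//.
rewrite -cLnorm_poweR ?gt_eqF//.
have := represents_lty xf; have := Lnorm_ge0 mu p%:E (fun z => (normc (f z))%:E).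
rewrite /cLnorm; case: (Lnorm _ _ _) => [r| |]// _ _; exact: ltry.
Qed.

Lemma represents_energy x f : represents x f -> `|x| = (energy f `^ p^-1)%:C.
Proof.
move=> xf; rewrite (represents_norm xf); congr (_ %:C).
have := cLnorm_poweR mu f (negbT (gt_eqF p0)).
have := represents_lty xf; have := Lnorm_ge0 mu p%:E (fun z => (normc (f z))%:E).
rewrite -/(cLnorm mu p f) /energy /Rintegral.
case: (cLnorm _ _ _) => [r| |]//; rewrite lee_fin => r0 _ <- /=.
by rewrite -powRrM divff ?gt_eqF// powRr1.
Qed.

Lemma energy_ge0 f : 0 <= energy f.
Proof. by apply: Rintegral_ge0 => z _; exact: powR_ge0. Qed.

Lemma represents_integrable x f : represents x f -> cintegrable mu f.
Proof.
move=> /represents_cLfun xf; apply: (cLfun_integrable p1 _ xf).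
by rewrite [X in (X < _)%E](_ : _ = 1%E) ?ltry//; exact: probability_setT.
Qed.

Lemma cLfun_monomial k : (fun z : circle R => circle_val z ^+ k) \in cLfun mu p.
Proof.
have one : (fun=> 1) \in cLfun mu p.
  apply/cLfunP; split; first by split; exact: measurable_cst.
  suff : (cLnorm mu p (fun=> 1%R) `^ p < +oo)%E.
    by have := Lnorm_ge0 mu p%:E (fun=> (normc (1%R : R[i]))%:E); rewrite /cLnorm;
      case: (Lnorm _ _ _) => [r| |]//= _; rewrite ?ltry// gt_eqF.
  rewrite cLnorm_poweR ?gt_eqF//; under eq_integral do rewrite normc1 powR1.
  rewrite integral_cst//= mul1e [X in (X < _)%E](_ : _ = 1%E) ?ltry//; exact: probability_setT.
by have := cLfun_circle_valX k%:Z p1 one; under eq_fun do rewrite mul1r.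
Qed.

Definition monomial_LpFun k : LpFun mu p1 := MkLpFun (cLfun_monomial k).

Lemma monomial_hardy k : Lp_class (monomial_LpFun k) \in @hardy R p p1.
Proof.
apply/hardyP => n n0; rewrite (fourier_coef_valX k%:Z) (_ : _ == _ = false)//.
by apply/negP => /eqP kn; move: n0; rewrite -kn.
Qed.

Definition monomial k : Hp p1 := MkHp (monomial_hardy k).

Lemma represents_monomial k : represents (monomial k) (fun z => circle_val z ^+ k).
Proof.
split; first exact: (cmeasurable_circle_valX (R := R) k).
exact: Lp_classK.
Qed.

Definition trigpoly (s : seq nat) (th : nat -> R[i]) (z : circle R) :=
  \sum_(k <- s) th k * circle_val z ^+ k.

Lemma represents_trigpoly s th :
  represents (\sum_(k <- s) th k *: monomial k) (trigpoly s th).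
Proof.
elim: s => [|k s ih].
  rewrite big_nil (_ : trigpoly _ _ = fun=> 0); first exact: represents0.
  by apply/funext => z; rewrite /trigpoly big_nil.
have -> : trigpoly (k :: s) th = fun z => th k * circle_val z ^+ k + trigpoly s th z.
  by apply/funext => z; rewrite /trigpoly big_cons.
rewrite big_cons; exact: representsD (representsZ _ (represents_monomial k)) ih.
Qed.

Lemma fourier_coef_trigpoly s th (k : nat) : k \notin s ->
  fourier_coef (trigpoly s th) k = 0.
Proof.
elim: s => [|l s ih].
  move=> _; rewrite /fourier_coef (_ : (fun z => _) = 0 *: (fun z =>
      circle_val z ^ (- k%:Z))); last first.
    by apply/funext => z; rewrite /trigpoly big_nil mul0r fctE scale0r.
  rewrite cintegralZ ?mul0r//.
  have := fourier_integrable (- k%:Z) p1 (cLfun_monomial 0).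
  by under eq_fun do rewrite expr0 mul1r.
rewrite inE negb_or => /andP[kl /ih h].
have -> : trigpoly (l :: s) th = th l *: (fun z => circle_val z ^+ l) + trigpoly s th.
  by apply/funext => z; rewrite /trigpoly big_cons !fctE.
rewrite (fourier_coef_lin _ _ p1 (cLfun_monomial l) (represents_cLfun (represents_trigpoly s
    th))).
by rewrite h addr0 (fourier_coef_valX l%:Z) eqz_nat eq_sym (negbTE kl) mulr0.
Qed.

End Hp_functions.

(** * The monomials are spread *)

Section monomials_spread.
Variables (R : realType) (p : R) (p1 : 1 <= p).
Local Notation mu := (circle_measure R).

Let p0 : 0 < p := lt_le_trans ltr01 p1.

Lemma integrable_bounded (f : circle R -> R) K : measurable_fun setT f ->
  (forall z, `|f z| <= K) -> mu.-integrable setT (EFin \o f).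
Proof.
move=> mf fK; have i1 : mu.-integrable setT (EFin \o cst 1%R).
  exact: finite_measure_integrable_cst.
have := integrable_bounded_mul mf fK i1.
by apply: eq_integrable => // z _ /=; rewrite mulr1.
Qed.

Lemma fine_circle_measureT : fine (mu setT) = 1.
Proof. by rewrite [X in fine X](_ : _ = 1%E)//; exact: probability_setT. Qed.

Lemma Rintegral_circle_cst (c : R) : \int[mu]_z c = c.
Proof. by rewrite Rintegral_cst// fine_circle_measureT mulr1. Qed.

Lemma normc_trigpoly_le s th z : (forall k, normc (th k) = 1) ->
  normc (trigpoly s th z) <= (size s)%:R :> R.
Proof.
move=> th1; elim: s => [|k s ih]; rewrite /trigpoly ?big_nil ?normc0// big_cons.
apply: le_trans (ler_normcD _ _) _.
by rewrite normcM th1 mul1r (normc_circle_valX z k) /= -natr1 addrC lerD2r.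
Qed.

(** Orthonormality of the monomials, in the form of Pythagoras' theorem for
    adding one monomial at a time. *)
Lemma integral_trigpoly_sqr s th : uniq s -> (forall k, normc (th k) = 1 :> R) ->
  \int[mu]_z (normc (trigpoly s th z) ^+ 2) = (size s)%:R.
Proof.
move=> + th1; elim: s => [|k s ih] /=.
  move=> _; rewrite -[RHS]Rintegral_circle_cst; apply: eq_Rintegral => z _.
  by rewrite /trigpoly big_nil normc0 expr0n.
move=> /andP[ks us].
have rS := represents_trigpoly p1 s th.
have [mS _] := rS.
have iS : mu.-integrable setT (EFin \o (fun z => normc (trigpoly s th z) ^+ 2)).
  apply: (@integrable_bounded _ ((size s)%:R ^+ 2)).
    by apply: measurable_funX; exact: cmeasurable_normc.
  move=> z; rewrite ger0_norm ?sqr_ge0// lerXn2r ?nnegrE ?normc_ge0//.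
  exact: normc_trigpoly_le.
pose c z := (th k)^*%C * (trigpoly s th z * circle_val z ^ (- k%:Z)).
have ic : cintegrable mu c.
  have mk : cmeasurable (fun z : circle R => (th k)^*%C * circle_val z ^ (- k%:Z)).
    apply: (cmeasurableM (f := fun=> (th k)^*%C)); last exact: cmeasurable_circle_valX.
    by split; exact: measurable_cst.
  have := @cintegrable_bounded_mul _ _ _ 1 (represents_integrable rS) mk.
  rewrite /c; under eq_fun do rewrite mulrCA; apply => z.
  by rewrite normcM normc_conj th1 normc_circle_valX mulr1.
have c0 : \int[mu]_z complex.Re (c z) = 0.
  have -> : \int[mu]_z complex.Re (c z) = complex.Re (cintegral mu c) by [].
  have -> : cintegral mu c = cintegral mu ((th k)^*%C *: (fun z =>
      trigpoly s th z * circle_val z ^ (- k%:Z))) by [].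
  rewrite cintegralZ; last exact: (fourier_integrable _ p1 (represents_cLfun rS)).
  by rewrite -/(fourier_coef _ _) (fourier_coef_trigpoly p1)// mulr0.
have E z : normc (trigpoly (k :: s) th z) ^+ 2 = (1 + normc (trigpoly s th z) ^+ 2) + 2 *
    complex.Re (c z).
  rewrite {1}/trigpoly big_cons normc_sqrD normcM th1 mul1r (normc_circle_valX z k) expr1n.
  rewrite addrAC; congr (_ + _ * complex.Re _); rewrite /c circle_valXN.
  have cM (z1 z2 : R[i]) : (z1 * z2)^*%C = z1^*%C * z2^*%C by exact: rmorphM.
  by rewrite cM -mulrA; congr (_ * _); rewrite mulrC.
under eq_Rintegral do rewrite E.
have i1 : mu.-integrable setT (EFin \o cst 1%R) by exact: finite_measure_integrable_cst.
have i1S : mu.-integrable setT (EFin \o (fun z => 1 + normc (trigpoly s th z) ^+ 2)).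
  by have := integrableD measurableT i1 iS; apply: eq_integrable.
have iRe : mu.-integrable setT (EFin \o (fun z => complex.Re (c z))) by case: ic.
have i2 : mu.-integrable setT (EFin \o (fun z => 2 * complex.Re (c z))).
  by have := integrableZl measurableT 2 iRe; apply: eq_integrable.
rewrite RintegralD// RintegralZl// c0 mulr0 addr0 RintegralD// ih//.
by rewrite Rintegral_circle_cst -natr1 addrC.
Qed.

Lemma spread_estimate (e J : R) : 0 < e -> 1 <= J ->
  2 / ((e / 2) ^+ 2 * e `^ p) < J ->
  (e / 2 * J) `^ p + J `^ p / (e / 2 * J) ^+ 2 * J <= (e * J) `^ p.
Proof.
move=> e0 J1 MJ; have J0 : 0 < J by lra.
have [a a0 aE] : exists2 a, 0 < a & e / 2 = a by exists (e / 2) => //; rewrite divr_gt0.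
rewrite aE in MJ *.
have ep : 0 < e `^ p by exact: powR_gt0.
have Jp : 0 < J `^ p by exact: powR_gt0.
rewrite !powRM ?(ltW a0) ?(ltW e0) ?(ltW J0)//.
have ap : a `^ p <= e `^ p / 2.
  rewrite -aE powRM ?(ltW e0) ?invr_ge0// ler_wpM2l ?powR_ge0//.
  by rewrite -[leRHS]powRr1 ?invr_ge0//; apply: ger_powR => //; lra.
have Kb : J `^ p / (a * J) ^+ 2 * J <= e `^ p / 2 * J `^ p.
  have h : 2 <= J * (a ^+ 2 * e `^ p).
    by rewrite -ler_pdivrMr ?mulr_gt0 ?exprn_gt0// ltW.
  have -> : J `^ p / (a * J) ^+ 2 * J = J `^ p * (a ^+ 2 * J)^-1.
    by field; rewrite !gt_eqF.
  rewrite mulrC ler_pM2r// ler_pdivlMr// ler_pdivrMl ?mulr_gt0 ?exprn_gt0//.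
  by rewrite mulrAC [_ * J]mulrC.
have := ler_wpM2r (ltW Jp) ap.
by move: Kb; rewrite [e `^ p / 2 * _]mulrAC => h1 h2; rewrite [leRHS]splitr; exact: lerD.
Qed.

(** A sum S of J unimodular multiples of monomials satisfies |S| <= J and has mean
    square J.  Where |S| <= a J its p-th power is at most (a J)^p; elsewhere
    |S|^p <= J^p |S|^2 / (a J)^2, whose integral is J^p / (a^2 J).  With a = e / 2
    and J large both are at most half of (e J)^p, whatever p is. *)
Lemma spread_monomial : spread (monomial p1).
Proof.
move=> e' e'0.
have [e e0 ->] : exists2 e : R, 0 < e & e' = e%:C.
  move: e'0; case: e' => a b; rewrite ltcE/= => /andP[/eqP-> a0]; by exists a.
pose a := e / 2; have a0 : 0 < a by rewrite divr_gt0.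
pose M := 2 / (a ^+ 2 * e `^ p).
have M0 : 0 <= M by rewrite divr_ge0// mulr_ge0// ?sqr_ge0 ?powR_ge0.
have [N MN] : exists N : nat, M < N.+1%:R.
  by exists (Num.truncn M); exact: truncnS_gt.
exists N.+1 => // s th us sJ th1.
have {}th1 k : normc (th k) = 1 by apply: complexI; rewrite Defs.normcE th1.
have [J JE] : exists J : R, J = N.+1%:R by exists N.+1%:R.
have MJ : M < J by rewrite JE.
have J1 : 1 <= J by rewrite JE ler1n.
rewrite (represents_energy (represents_trigpoly p1 s th)).
rewrite -[_%:R](rmorph_nat (real_complex R)) -rmorphM lecR -JE.
have J0 : 0 < J := lt_le_trans ltr01 J1.
have aJ : 0 < a * J by rewrite mulr_gt0.
have bnd : energy p (trigpoly s th) <= (e * J) `^ p.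
  pose K := J `^ p / (a * J) ^+ 2.
  have K0 : 0 <= K by rewrite divr_ge0 ?powR_ge0 ?sqr_ge0.
  have rS := represents_trigpoly p1 s th.
  have [mS _] := rS.
  have iS : mu.-integrable setT (EFin \o (fun z => normc (trigpoly s th z) ^+ 2)).
    apply: (@integrable_bounded _ ((size s)%:R ^+ 2)).
      by apply: measurable_funX; exact: cmeasurable_normc.
    move=> z; rewrite ger0_norm ?sqr_ge0// lerXn2r ?nnegrE ?normc_ge0//.
    exact: normc_trigpoly_le.
  have iKS : mu.-integrable setT (EFin \o (fun z => K * normc (trigpoly s th z) ^+ 2)).
    by have := integrableZl measurableT K iS; apply: eq_integrable.
  have ic : mu.-integrable setT (EFin \o cst ((a * J) `^ p)) by exact:
      finite_measure_integrable_cst.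
  have iR : mu.-integrable setT (EFin \o (fun z =>
      (a * J) `^ p + K * normc (trigpoly s th z) ^+ 2)).
    by have := integrableD measurableT ic iKS; apply: eq_integrable.
  apply: le_trans (_ : \int[mu]_z ((a * J) `^ p + K * normc (trigpoly s th z) ^+ 2) <= _).
    apply: le_Rintegral => //; first exact: represents_integrable_powR rS.
    move=> z _; have SJ : normc (trigpoly s th z) <= J.
      by rewrite JE -sJ; exact: normc_trigpoly_le.
    have S0 := normc_ge0 (trigpoly s th z).
    have [Sa|Sa] := leP (normc (trigpoly s th z)) (a * J).
      rewrite -[leLHS]addr0; apply: lerD; last by rewrite mulr_ge0// sqr_ge0.
      by apply: ge0_ler_powR; rewrite ?nnegrE// ltW.
    rewrite -[leLHS]add0r; apply: lerD; first exact: powR_ge0.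
    rewrite /K mulrAC ler_pdivlMr ?exprn_gt0//; apply: ler_pM; rewrite ?powR_ge0 ?sqr_ge0//.
      by apply: ge0_ler_powR; rewrite ?nnegrE ?(ltW p0)//; exact: le_trans SJ.
    by rewrite lerXn2r ?nnegrE// ltW.
  rewrite RintegralD// RintegralZl// integral_trigpoly_sqr// sJ -JE Rintegral_circle_cst.
  exact: spread_estimate.
apply: le_trans (ge0_ler_powR _ _ _ bnd) _; rewrite ?nnegrE ?invr_ge0 ?energy_ge0 ?powR_ge0
    ?(ltW p0)//.
by rewrite -powRrM divff ?gt_eqF// powRr1// mulr_ge0// ltW.
Qed.

End monomials_spread.

(** * The remainder of the first order expansion *)

Section averaged_energy.
Variables (R : realType) (p : R) (p1 : 1 <= p).
Local Notation mu := (circle_measure R).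
Implicit Types (u : circle R -> R) (x : Hp p1) (g : circle R -> R[i]).

Let p0 : 0 < p := lt_le_trans ltr01 p1.

Lemma gauge_le r : 0 <= r -> gauge p r <= r + r `^ p.
Proof.
move=> r0; rewrite /gauge; case: ifPn => [r16|_]; last by rewrite lerDr.
have := powR_ge0 r p; nra.
Qed.

Lemma gauge_scaled_le N r : 1 <= N -> 0 <= r -> N * gauge p (r / N) <= r + r `^ p.
Proof.
move=> N1 r0; have N0 : 0 < N := lt_le_trans ltr01 N1.
rewrite /gauge; case: ifPn => [r16|_].
  have -> : N * (r / N) ^+ 2 = r * (r / N) by field; rewrite gt_eqF.
  apply: le_trans (_ : r <= _); last by rewrite lerDl powR_ge0.
  by rewrite ler_piMr//; apply: le_trans r16 _; lra.
rewrite powRM ?invr_ge0 ?(ltW N0)// mulrCA.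
apply: le_trans (_ : r `^ p <= _); last by rewrite lerDr.
rewrite ler_piMr ?powR_ge0// -ler_pdivlMl// mulr1; apply: ge1r_powR => //.
by rewrite invr_gt0 N0 invf_le1.
Qed.

Lemma measurable_gauge u : measurable_fun setT u -> measurable_fun setT (fun z =>
    gauge p (u z)).
Proof.
move=> mgu; rewrite /gauge; apply: measurable_fun_ifT.
- by apply: measurable_fun_ler => //; exact: measurable_cst.
- exact: measurable_funX.
- exact: (@measurableT_comp _ _ _ _ _ _ (@powR R ^~ p)).
Qed.

Lemma integrable_gauge u : (forall z, 0 <= u z) ->
  mu.-integrable setT (EFin \o u) ->
  mu.-integrable setT (EFin \o (fun z => u z `^ p)) ->
  mu.-integrable setT (EFin \o (fun z => gauge p (u z))).
Proof.
move=> u0 iu iup.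
have mgu : measurable_fun setT u by apply/measurable_EFinP; exact: measurable_int iu.
have iD := integrableD measurableT iu iup.
apply: le_integrable iD => //; first exact/measurable_EFinP/measurable_gauge.
move=> z _ /=; rewrite lee_fin ger0_norm ?gauge_ge0//.
by apply: le_trans (gauge_le (u0 z)) _; exact: ler_norm.
Qed.

(** The integrated error at u / n is o(1 / n), by dominated convergence.  For p = 1
    this holds only because the gauge is quadratic near 0. *)
Lemma gauge_cvg0 u : (forall z, 0 <= u z) ->
  mu.-integrable setT (EFin \o u) ->
  mu.-integrable setT (EFin \o (fun z => u z `^ p)) ->
  \int[mu]_z (n.+1%:R * gauge p (u z / n.+1%:R)) @[n --> \oo] --> 0.
Proof.
move=> u0 iu iup.
have mgu : measurable_fun setT u by apply/measurable_EFinP; exact: measurable_int iu.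
have iD := integrableD measurableT iu iup.
pose h n z := n.+1%:R * gauge p (u z / n.+1%:R).
have mh n : measurable_fun setT (EFin \o h n).
  apply/measurable_EFinP; apply: measurable_funM; first exact: measurable_cst.
  apply: measurable_gauge; apply: measurable_funM => //; exact: measurable_cst.
have [||_ _ +] := dominated_convergence measurableT mh (measurable_cst (0%R%:E)) _ iD _.
- apply/nearW => z _ /=; apply/fine_cvgP; split; first exact: nearW.
  have [m um] : exists m : nat, 16 * u z < m%:R.
    by exists (Num.truncn (16 * u z)).+1; exact: truncnS_gt.
  have : (u z ^+ 2) * n.+1%:R^-1 @[n --> \oo] --> (0 : R).
    by rewrite -[X in _ --> X](mulr0 (u z ^+ 2)); apply: cvgMr; exact: cvg_harmonic.
  apply: cvg_trans; apply: near_eq_cvg; near=> n; rewrite /h /= /gauge.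
  have N0 : 0 < n.+1%:R :> R by rewrite ltr0n.
  have -> : u z / n.+1%:R <= 1 / 16.
    rewrite ler_pdivrMr// mulrC mulrA mulr1 ler_pdivlMr// mulrC.
    apply: le_trans (ltW um) _; rewrite ler_nat; apply: leqW.
    by near: n; exact: nbhs_infty_ge.
  by move: N0; move: n.+1%:R => N N0; field; rewrite gt_eqF.
- apply/nearW => z n _ /=; rewrite lee_fin /h.
  rewrite ger0_norm ?mulr_ge0 ?gauge_ge0//.
  by apply: gauge_scaled_le => //; rewrite ler1n.
rewrite integral_cst//= mul0e => /fine_cvg; exact.
Unshelve. all: by end_near. Qed.

End averaged_energy.

(** * The averaged first variation *)

Section averaged.
Variables (R : realType) (p : R) (p1 : 1 <= p).
Local Notation mu := (circle_measure R).
Implicit Types (u : circle R -> R) (x : Hp p1) (g : circle R -> R[i]).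

Let p0 : 0 < p := lt_le_trans ltr01 p1.

Lemma Rintegral_sum (I : Type) (s : seq I) (F : I -> circle R -> R) :
  (forall i, mu.-integrable setT (EFin \o F i)) ->
  mu.-integrable setT (EFin \o (fun z => \sum_(i <- s) F i z)) /\
  \int[mu]_z (\sum_(i <- s) F i z) = \sum_(i <- s) \int[mu]_z F i z.
Proof.
move=> iF; elim: s => [|i s [ihi ihe]].
  split; last first.
    rewrite big_nil -[RHS](Rintegral_circle_cst (0 : R)).
    by apply: eq_Rintegral => z _; rewrite big_nil.
  have : mu.-integrable setT (EFin \o cst (0 : R)) by exact: finite_measure_integrable_cst.
  by apply: eq_integrable => // z _ /=; rewrite big_nil.
split.
  have := integrableD measurableT (iF i) ihi.
  by apply: eq_integrable => // z _ /=; rewrite big_cons EFinD.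
rewrite big_cons -ihe -RintegralD//.
by apply: eq_Rintegral => z _; rewrite big_cons.
Qed.

(** The test vectors w1 z^k (1 + d w2 (z^(k-j) + conj w1)).  The exponent k + k - j
    is a truncated subtraction, used for j <= k. *)
Definition probe (d : R) (j k : nat) (w1 w2 : R[i]) : Hp p1 :=
  (w1 + d%:C * w2) *: monomial p1 k + (d%:C * w1 * w2) *: monomial p1 (k + k - j)%N.

Definition probe_fun (d : R) (j k : nat) (w1 w2 : R[i]) (z : circle R) : R[i] :=
  (w1 + d%:C * w2) * circle_val z ^+ k + (d%:C * w1 * w2) * circle_val z ^+ (k + k - j)%N.

Lemma represents_probe d j k w1 w2 : represents (probe d j k w1 w2) (probe_fun d j k w1 w2).
Proof.
exact: representsD (representsZ _ (represents_monomial p1 k))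
  (representsZ _ (represents_monomial p1 (k + k - j)%N)).
Qed.

Lemma conj_quarter (w : R[i]) : w \in @quarter R -> w * w^*%C = 1.
Proof. by move=> /normc_quarter w1; rewrite -sqr_normc -Defs.normcE w1 expr1n. Qed.

Lemma probe_funE d j k w1 w2 z : (j <= k)%N -> w1 \in @quarter R ->
  probe_fun d j k w1 w2 z =
  w1 * circle_val z ^+ k * (1 + perturbation d (circle_val z ^+ (k - j)) w1 w2).
Proof.
move=> jk /conj_quarter w1c; rewrite /probe_fun /perturbation -addnBA// exprD.
by ring: w1c.
Qed.

Lemma normc_mono w1 k (z : circle R) (v : R[i]) : w1 \in @quarter R ->
  normc (w1 * circle_val z ^+ k * v) = normc v.
Proof. by move=> /normc_quarter w1q; rewrite !normcM w1q (normc_circle_valX z k) !mul1r. Qed.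

Lemma represents_integrable_normc x g : represents x g ->
  mu.-integrable setT (EFin \o (fun z => normc (g z))).
Proof.
move=> xg; have [mg _] := xg.
have [/integrable_norm ir /integrable_norm ii] := represents_integrable xg.
have := integrableD measurableT ir ii; apply: le_integrable => //.
  by apply/measurable_EFinP; exact: cmeasurable_normc.
move=> z _ /=; rewrite lee_fin ger0_norm ?normc_ge0// ger0_norm ?addr_ge0//.
rewrite -(ler_pXn2r (n := 2)) ?nnegrE ?normc_ge0 ?addr_ge0// normc_sqr.
rewrite -[complex.Re _ ^+ 2]real_normK ?num_real// -[complex.Im _ ^+ 2]real_normK ?num_real//.
by rewrite sqrrD -addrA lerD2l lerDr mulrn_wge0 ?mulr_ge0.
Qed.

(** The pointwise inequality is applied at Z = z^(k-j) and y = s z^(-k) g(z); then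
    Z y = s g(z) z^(-j), whose integral is s times the j-th Fourier coefficient. *)
Lemma sum_energy_probe_le : exists2 C : R, 0 <= C &
  forall x g (d : R) (j k : nat) (s : R[i]), represents x g -> 0 <= d <= 1 / 16 -> (j <=
      k)%N ->
  \sum_(w1 <- @quarter R) \sum_(w2 <- @quarter R)
    (energy p (fun z => probe_fun d j k w1 w2 z + s * g z) - energy p (probe_fun d j k w1
        w2)) <=
  4 * p ^+ 2 * (p - 2) * d ^+ 2 * complex.Re (s * fourier_coef g j) +
  C * (d ^+ 3 * (normc s * \int[mu]_z normc (g z))) +
  C * \int[mu]_z gauge p (normc s * normc (g z)).
Proof.
have [C C0 ptw] := sum_normc_perturbation_le p1; exists C => //.
move=> x g d j k s xg d01 jk.
have xsg w1 w2 := representsD (represents_probe d j k w1 w2) (representsZ s xg).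
have iE w1 w2 : mu.-integrable setT (EFin \o (fun z =>
    normc (probe_fun d j k w1 w2 z + s * g z) `^ p - normc (probe_fun d j k w1 w2 z) `^ p)).
  have := integrableB measurableT (represents_integrable_powR (xsg w1 w2))
    (represents_integrable_powR (represents_probe d j k w1 w2)).
  by apply: eq_integrable.
have iE2 w1 := (Rintegral_sum (@quarter R) (iE w1)).1.
have [iS ES] := Rintegral_sum (@quarter R) iE2.
have -> : \sum_(w1 <- @quarter R) \sum_(w2 <- @quarter R)
    (energy p (fun z => probe_fun d j k w1 w2 z + s * g z) - energy p (probe_fun d j k w1
        w2)) =
    \int[mu]_z \sum_(w1 <- @quarter R) \sum_(w2 <- @quarter R)
    (normc (probe_fun d j k w1 w2 z + s * g z) `^ p - normc (probe_fun d j k w1 w2 z) `^ p).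
  rewrite ES; apply: eq_bigr => w1 _; rewrite (Rintegral_sum (@quarter R) (iE w1)).2.
  apply: eq_bigr => w2 _; rewrite RintegralB//.
    exact: (represents_integrable_powR (xsg w1 w2)).
  exact: (represents_integrable_powR (represents_probe d j k w1 w2)).
pose A := 4 * p ^+ 2 * (p - 2) * d ^+ 2.
pose c z := s * (g z * circle_val z ^ (- j%:Z)).
have ig := represents_integrable xg.
have mg : cmeasurable g by case: xg.
have igj := fourier_integrable (- j%:Z) p1 (represents_cLfun xg).
have ic : cintegrable mu c.
  have ms : cmeasurable (fun z : circle R => s) by split; exact: measurable_cst.
  have := cintegrable_bounded_mul igj ms (fun=> lexx _).
  by under eq_fun do rewrite mulrC.
have inorm := represents_integrable_normc xg.
have ing : mu.-integrable setT (EFin \o (fun z => normc s * normc (g z))).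
  by have := integrableZl measurableT (normc s) inorm; apply: eq_integrable.
have isp : mu.-integrable setT (EFin \o (fun z => (normc s * normc (g z)) `^ p)).
  have := represents_integrable_powR (representsZ s xg).
  by apply: eq_integrable => // z _ /=; rewrite normcM.
have sg0 z : 0 <= normc s * normc (g z) by rewrite mulr_ge0 ?normc_ge0.
have igau := integrable_gauge sg0 ing isp.
have i1 : mu.-integrable setT (EFin \o (fun z => A * complex.Re (c z))).
  by have := integrableZl measurableT A ic.1; apply: eq_integrable.
have i2 : mu.-integrable setT (EFin \o (fun z => (C * d ^+ 3) * (normc s * normc (g z)))).
  by have := integrableZl measurableT (C * d ^+ 3) ing; apply: eq_integrable.
have i3 : mu.-integrable setT (EFin \o (fun z => C * gauge p (normc s * normc (g z)))).
  by have := integrableZl measurableT C igau; apply: eq_integrable.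
have i12 : mu.-integrable setT (EFin \o (fun z => A * complex.Re (c z) + (C * d ^+ 3) *
    (normc s * normc (g z)))).
  by have := integrableD measurableT i1 i2; apply: eq_integrable.
have i123 : mu.-integrable setT (EFin \o (fun z =>
    A * complex.Re (c z) + (C * d ^+ 3) * (normc s * normc (g z)) + C * gauge p (normc s *
        normc (g z)))).
  by have := integrableD measurableT i12 i3; apply: eq_integrable.
apply: le_trans (_ : \int[mu]_z (A * complex.Re (c z) + (C * d ^+ 3) * (normc s * normc (g
    z)) + C * gauge p (normc s * normc (g z))) <= _).
  apply: le_Rintegral => // z _.
  pose y := circle_val z ^ (- k%:Z) * (s * g z).
  have ny : normc y = normc s * normc (g z) by rewrite /y normcM normc_circle_valX mul1r
      normcM.
  have Z1 : normc (circle_val z ^+ (k - j)) = 1 := normc_circle_valX z (k - j)%N.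
  have := ptw d _ y d01 Z1; rewrite ny -/A.
  have -> : circle_val z ^+ (k - j) * y = c z.
    have zj : circle_val z ^+ (k - j) * circle_val z ^ (- k%:Z) = circle_val z ^ (- j%:Z).
      rewrite exprnP -expfzDr ?circle_val_neq0//; congr (_ ^ _).
      by rewrite -subzn//; ring.
    by rewrite /y mulrA zj /c; ring.
  rewrite mulrA; apply: le_trans; rewrite le_eqVlt; apply/orP; left; apply/eqP.
  rewrite big_seq [RHS]big_seq; apply: eq_bigr => w1 w1q; apply: eq_bigr => w2 _.
  rewrite probe_funE// normc_mono//; congr (_ `^ _ - _).
  rewrite -[RHS](normc_mono k z _ w1q); congr normc; rewrite [RHS]mulrDr; congr (_ + _).
  have zk : circle_val z ^+ k * circle_val z ^ (- k%:Z) = 1.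
    by rewrite exprnP -expfzDr ?circle_val_neq0// subrr expr0z.
  have w1c := conj_quarter w1q; rewrite /y; by ring: w1c zk.
rewrite RintegralD// RintegralD// RintegralZl//; last exact: ic.1.
rewrite RintegralZl// [X in _ + X <= _]RintegralZl//.
have -> : \int[mu]_z complex.Re (c z) = complex.Re (s * fourier_coef g j).
  by rewrite /fourier_coef -cintegralZ.
rewrite -/A.
have -> : \int[mu]_z (normc s * normc (g z)) = normc s * \int[mu]_z normc (g z).
  by rewrite RintegralZl.
by rewrite mulrA.
Qed.
End averaged.

(** * Nonexistence of the projection *)

Lemma contractive_le (R : realType) (X : normedModType R[i]) (P : {linear X -> X}) :
  operator_norm P = 1%E -> forall x, `|P x| <= `|x|.
Proof.
move=> P1 x; have [->|x0] := eqVneq x 0; first by rewrite raddf0 normr0.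
have nx : `|x| != 0 by rewrite normr_eq0.
pose u := `|x|^-1 *: x.
have u1 : `|u| <= 1 by rewrite normrZ normfV normr_id mulVf.
have : ((complex.Re `|P u|)%:E <= 1)%E.
  by rewrite -P1; apply: ereal_sup_ubound; exists u.
rewrite lee_fin => Pu1.
have {}Pu1 : `|P u| <= 1.
  have := normr_ge0 (P u); move: Pu1; case: `|P u| => a b /= a1.
  by rewrite lecE/= => /andP[/eqP-> a0]; rewrite lecE/= eqxx.
have -> : P x = `|x| *: P u by rewrite -linearZ/= scalerA mulfV// scale1r.
by rewrite normrZ normr_id -[leRHS]mulr1 ler_wpM2l.
Qed.

Lemma norm_le_near (R : realType) (X : normedModType R[i]) (x y w : X) (r : R[i]) :
  `|y| <= `|y + w| -> `|x - y| <= r -> `|x| <= `|x + w| + (r + r).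
Proof.
move=> yw xy; have -> : x = y + (x - y) by rewrite addrC subrK.
apply: le_trans (ler_normD _ _) _; rewrite addrA; apply: lerD => //.
apply: le_trans yw _.
have -> : y + w = (y + (x - y) + w) - (x - y) by rewrite addrAC addrK.
by apply: le_trans (ler_normB _ _) _; rewrite lerD2l.
Qed.

Section no_projection.
Variables (R : realType) (p : R) (p1 : 1 <= p).
Local Notation mu := (circle_measure R).

Let p0 : 0 < p := lt_le_trans ltr01 p1.

Lemma probe_fun_bounds (d : R) j k (w1 w2 : R[i]) z : 0 <= d <= 1 / 16 -> (j <= k)%N ->
  w1 \in @quarter R -> w2 \in @quarter R ->
  1 / 2 <= normc (probe_fun d j k w1 w2 z) <= 2.
Proof.
move=> /andP[d0 d16] jk w1q w2q; rewrite probe_funE// normc_mono//.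
have e : normc (perturbation d (circle_val z ^+ (k - j)) w1 w2) <= 1 / 8.
  rewrite /perturbation !normcM (normc_quarter w2q) normc_real (ger0_norm d0) mul1r.
  have h := ler_normcD (circle_val z ^+ (k - j)) w1^*%C.
  rewrite normc_conj (normc_quarter w1q) (normc_circle_valX z (k - j)%N) in h.
  have := normc_ge0 (circle_val z ^+ (k - j) + w1^*%C); nra.
move: e; move: (perturbation _ _ _ _) => v v8.
have h1 := ler_normcD 1 v; have h2 := ler_normcD (1 + v) (- v).
rewrite addrK normcN !normc1 in h1 h2; apply/andP; split; lra.
Qed.

Lemma energy_probe_bounds (d : R) j k (w1 w2 : R[i]) : 0 <= d <= 1 / 16 -> (j <= k)%N ->
  w1 \in @quarter R -> w2 \in @quarter R ->
  (1 / 2) `^ p <= energy p (probe_fun d j k w1 w2) <= 2 `^ p.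
Proof.
move=> d01 jk w1q w2q.
have ip := represents_integrable_powR (represents_probe p1 d j k w1 w2).
have ic (c : R) : mu.-integrable setT (EFin \o cst c) by exact: finite_measure_integrable_cst.
rewrite -[X in X <= _](Rintegral_circle_cst ((1 / 2) `^ p)) -[X in _ <= _ <=
    X](Rintegral_circle_cst (2 `^ p)).
have ptw z := probe_fun_bounds z d01 jk w1q w2q.
apply/andP; split; apply: le_Rintegral => //; try exact: ic.
  move=> z _; have /andP[b1 _] := ptw z.
  by apply: ge0_ler_powR; rewrite ?nnegrE ?normc_ge0 ?(ltW p0)//.
move=> z _; have /andP[_ b2] := ptw z.
by apply: ge0_ler_powR; rewrite ?nnegrE ?normc_ge0 ?(ltW p0)//.
Qed.

(** The coefficients of the test vectors are bounded by 2 and 1, whatever k is. *)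
Lemma probe_near (Y : set (Hp p1)) (d : R) j (eta : R) : 0 <= d <= 1 / 16 -> 0 < eta ->
  submod_closed (mem Y) -> approaches (monomial p1) Y ->
  exists2 k, (j <= k)%N & forall w1 w2, w1 \in @quarter R -> w2 \in @quarter R ->
    exists2 y, Y y & `|probe p1 d j k w1 w2 - y| <= eta%:C.
Proof.
move=> /andP[d0 d16] eta0.
have d2 : 1 + d <= 2 by lra.
have d1 : d <= 1 by lra.
have etaE : 2 * (eta / 3) + 1 * (eta / 3) <= eta by lra.
move=> [Y0 YD] near_Y.
have e30 : 0 < (eta / 3)%:C by rewrite ltcR divr_gt0.
have [k0 hk0] := near_Y _ e30.
exists (k0 + j)%N; first by rewrite leq_addl.
move=> w1 w2 w1q w2q; set k := (k0 + j)%N.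
have [y1 Yy1 h1] : exists2 y, Y y & `|monomial p1 k - y| <= (eta / 3)%:C.
  by apply: hk0; rewrite /k leq_addr.
have [y2 Yy2 h2] : exists2 y, Y y & `|monomial p1 (k + k - j)%N - y| <= (eta / 3)%:C.
  by apply: hk0; rewrite /k -addnBA ?leq_addl// addnK leq_addl.
exists ((w1 + d%:C * w2) *: y1 + (d%:C * w1 * w2) *: y2).
  apply: set_mem; apply: (YD _ _ _ (mem_set Yy1)).
  by rewrite -[_ *: y2]addr0; apply: (YD _ _ _ (mem_set Yy2)).
have -> : probe p1 d j k w1 w2 - ((w1 + d%:C * w2) *: y1 + (d%:C * w1 * w2) *: y2) =
    (w1 + d%:C * w2) *: (monomial p1 k - y1) + (d%:C * w1 * w2) *:
        (monomial p1 (k + k - j)%N - y2).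
  by rewrite !scalerBr /probe opprD addrACA.
apply: le_trans (ler_normD _ _) _; rewrite !normrZ.
have c1 : `|w1 + d%:C * w2| <= (2 : R)%:C.
  rewrite -Defs.normcE lecR; apply: le_trans (ler_normcD _ _) _.
  rewrite normcM normc_real (normc_quarter w1q) (normc_quarter w2q) (ger0_norm d0) mulr1.
  exact: d2.
have c2 : `|d%:C * w1 * w2| <= (1 : R)%:C.
  rewrite -Defs.normcE lecR !normcM normc_real (normc_quarter w1q) (normc_quarter w2q)
      (ger0_norm d0) !mulr1.
  exact: d1.
apply: (@le_trans _ _ ((2 : R)%:C * (eta / 3)%:C + (1 : R)%:C * (eta / 3)%:C)).
  by apply: lerD; apply: ler_pM; rewrite -?normrM.
by rewrite -!rmorphM -rmorphD lecR.
Qed.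

(** A fixed error on the norms costs a fixed proportion of their p-th powers, as
    long as these are bounded below. *)
Lemma powR_root_stable (eps : R) : 0 < eps < 1 -> exists2 eta : R, 0 < eta &
  forall E E' : R, (1 / 2) `^ p <= E -> 0 <= E' ->
  E `^ p^-1 <= E' `^ p^-1 + 2 * eta -> (1 - eps) * E <= E'.
Proof.
move=> /andP[eps0 eps1]; pose r := (1 - eps) `^ p^-1.
have r0 : 0 <= r by exact: powR_ge0.
have r1 : r < 1.
  have -> : 1 = 1 `^ p^-1 :> R by rewrite powR1.
  by apply: gt0_ltr_powR; rewrite ?nnegrE ?invr_gt0//; lra.
have rp : r `^ p = 1 - eps.
  by rewrite /r -powRrM mulVf ?gt_eqF// powRr1//; lra.
exists ((1 - r) / 4); first by rewrite divr_gt0//; lra.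
move=> E E' E2 E'0 EE'.
have h0 : 0 <= 1 / 2 :> R by rewrite divr_ge0.
have E0 : 0 <= E := le_trans (powR_ge0 _ _) E2.
have aE : 1 / 2 <= E `^ p^-1.
  have {1}-> : 1 / 2 = ((1 / 2) `^ p) `^ p^-1 :> R by rewrite -powRrM divff ?gt_eqF// powRr1.
  by apply: ge0_ler_powR; rewrite ?nnegrE ?invr_ge0 ?(ltW p0) ?powR_ge0.
have rE : r * E `^ p^-1 <= E' `^ p^-1.
  have : (1 - r) * (1 / 2) <= (1 - r) * E `^ p^-1 by rewrite ler_wpM2l//; lra.
  by move: EE'; clearbody r; lra.
have root F : 0 <= F -> (F `^ p^-1) `^ p = F.
  by move=> F0; rewrite -powRrM mulVf ?gt_eqF// powRr1.
have := ge0_ler_powR (ltW p0) _ _ rE; rewrite !nnegrE mulr_ge0 ?powR_ge0// => /(_ isT isT).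
by rewrite powRM ?powR_ge0// rp !root.
Qed.

Lemma energy_probe_le (Y : set (Hp p1)) (v : Hp p1) g : represents v g ->
  submod_closed (mem Y) -> approaches (monomial p1) Y ->
  (forall y s, Y y -> `|y| <= `|y + s *: v|) ->
  forall (d : R) j (eps : R) (s : R[i]), 0 <= d <= 1 / 16 -> 0 < eps < 1 ->
  exists2 k, (j <= k)%N & forall w1 w2, w1 \in @quarter R -> w2 \in @quarter R ->
    energy p (probe_fun d j k w1 w2) - eps * 2 `^ p <=
    energy p (fun z => probe_fun d j k w1 w2 z + s * g z).
Proof.
move=> vg sY nearY bj d j eps s d01 eps01.
have [eta eta0 stable] := powR_root_stable eps01.
have [k jk hk] := probe_near j d01 eta0 sY nearY; exists k => // w1 w2 w1q w2q.
have [y Yy xy] := hk _ _ w1q w2q.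
have xf := represents_probe p1 d j k w1 w2.
have xsf := representsD xf (representsZ s vg).
set x := probe p1 d j k w1 w2 in xy xf xsf.
have /andP[E1 E2] := energy_probe_bounds d01 jk w1q w2q.
apply: le_trans (stable _ _ E1 (energy_ge0 p _) _).
  by rewrite mulrBl mul1r lerD2l lerN2 ler_wpM2l//; case/andP: eps01 => /ltW.
have := norm_le_near (bj y s Yy) xy.
rewrite (represents_energy xf) (represents_energy xsf) -!rmorphD lecR.
by rewrite mulr2n mulrDl mul1r.
Qed.

(** The constant C is uniform in d, j and s, since first s and then d will be
    sent to 0. *)
Lemma first_variation_ge0 (Y : set (Hp p1)) (v : Hp p1) g : represents v g ->
  submod_closed (mem Y) -> approaches (monomial p1) Y ->
  (forall y s, Y y -> `|y| <= `|y + s *: v|) ->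
  exists2 C : R, 0 <= C & forall (d : R) (j : nat) (s : R[i]), 0 <= d <= 1 / 16 ->
    0 <= 4 * p ^+ 2 * (p - 2) * d ^+ 2 * complex.Re (s * fourier_coef g j) +
      C * (d ^+ 3 * (normc s * \int[mu]_z normc (g z))) +
      C * \int[mu]_z gauge p (normc s * normc (g z)).
Proof.
have small (e : R) : 0 < e -> exists2 eps : R, 0 < eps < 1 & 16 * (eps * 2 `^ p) <= e.
  move=> e0; have P0 : 0 < 2 `^ p :> R by exact: powR_gt0.
  have D0 : 0 < 16 * 2 `^ p + 2 * e by lra.
  exists (e / (16 * 2 `^ p + 2 * e)); first by rewrite divr_gt0//= ltr_pdivrMr//; lra.
  have -> : 16 * (e / (16 * 2 `^ p + 2 * e) * 2 `^ p) =
      e * (16 * 2 `^ p / (16 * 2 `^ p + 2 * e)) by field; rewrite gt_eqF.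
  by rewrite ger_pMr// ler_pdivrMr//; lra.
have quarter_cst (c : R) : - (16 * c) = \sum_(w1 <- @quarter R) \sum_(w2 <- @quarter R) - c.
  by rewrite /quarter !big_cons !big_nil; ring.
move=> vg sY nearY bj; have [C C0 up] := sum_energy_probe_le p1.
exists C => // d j s d01; apply/ler_addgt0Pr => e /small[eps eps01 epsle].
have [k jk hk] := energy_probe_le vg sY nearY bj j s d01 eps01.
rewrite -lerBlDr sub0r; apply: le_trans (up _ _ d j k s vg d01 jk).
apply: (@le_trans _ _ (- (16 * (eps * 2 `^ p)))); first by rewrite lerN2.
rewrite quarter_cst big_seq [leRHS]big_seq; apply: ler_sum => w1 w1q.
rewrite big_seq [leRHS]big_seq; apply: ler_sum => w2 w2q.
by rewrite lerBrDr addrC; exact: hk.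
Qed.

Lemma gauge_limit_ge0 u (a C : R) : (forall z, 0 <= u z) ->
  mu.-integrable setT (EFin \o u) ->
  mu.-integrable setT (EFin \o (fun z => u z `^ p)) ->
  (forall t, 0 < t -> 0 <= t * a + C * \int[mu]_z gauge p (t * u z)) -> 0 <= a.
Proof.
move=> u0 iu iup h.
suff key N : 0 < N -> 0 <= a + C * \int[mu]_z (N * gauge p (u z / N)).
  have lim : a + C * \int[mu]_z (n.+1%:R * gauge p (u z / n.+1%:R)) @[n --> \oo] --> a + C * 0.
    by apply: cvgD; [exact: cvg_cst|apply: cvgMr; exact: gauge_cvg0].
  rewrite mulr0 addr0 in lim; apply: (cvgr_to_ge lim).
  by apply: nearW => n; exact: key (ltr0Sn _ n).
move=> N0.
have V0 : 0 <= N^-1 by rewrite invr_ge0 ltW.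
have un0 z : 0 <= N^-1 * u z by rewrite mulr_ge0.
have iun : mu.-integrable setT (EFin \o (fun z => N^-1 * u z)).
  by have := integrableZl measurableT N^-1 iu; apply: eq_integrable.
have iunp : mu.-integrable setT (EFin \o (fun z => (N^-1 * u z) `^ p)).
  have := integrableZl measurableT (N^-1 `^ p) iup.
  by apply: eq_integrable => // z _ /=; rewrite powRM.
have -> : \int[mu]_z (N * gauge p (u z / N)) = N * \int[mu]_z gauge p (N^-1 * u z).
  have ig := integrable_gauge un0 iun iunp.
  rewrite -[RHS](RintegralZl N measurableT ig).
  by apply: eq_Rintegral => z _; rewrite [u z / _]mulrC.
have := mulr_ge0 (ltW N0) (h N^-1 _); rewrite invr_gt0 => /(_ N0).
by rewrite mulrDr mulrA divff ?gt_eqF// mul1r mulrCA.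
Qed.

Lemma quadratic_le_cubic (A K : R) : 0 <= K ->
  (forall d, 0 <= d <= 1 / 16 -> A * d ^+ 2 <= K * d ^+ 3) -> A <= 0.
Proof.
move=> K0 h; rewrite leNgt; apply/negP => A0.
have D0 : 0 < 16 * (A + K) by lra.
pose d := A / (16 * (A + K)).
have d0 : 0 < d by rewrite divr_gt0.
have d16 : d <= 1 / 16 by rewrite /d ler_pdivrMr//; lra.
have := h d; rewrite ltW//= => /(_ d16).
rewrite [d ^+ 3]exprS mulrA ler_pM2r ?exprn_gt0// /d mulrA ler_pdivlMr//.
by have := mulr_gt0 A0 A0; have := mulr_ge0 (ltW A0) K0; lra.
Qed.

(** The direction s = - (p - 2) conj c, where c is the Fourier coefficient, makes
    the main term negative unless c = 0.  Letting first s and then d tend to 0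
    along this direction eliminates the two error terms. *)
Lemma fourier_coef_eq0 (Y : set (Hp p1)) (v : Hp p1) g : p != 2 -> represents v g ->
  submod_closed (mem Y) -> approaches (monomial p1) Y ->
  (forall y s, Y y -> `|y| <= `|y + s *: v|) ->
  forall j : nat, fourier_coef g j = 0.
Proof.
move=> p2 vg sY nearY bj j.
have [C C0 var] := first_variation_ge0 vg sY nearY bj.
pose G := \int[mu]_z normc (g z).
have G0 : 0 <= G by apply: Rintegral_ge0 => z _; exact: normc_ge0.
pose c := fourier_coef g j; pose s : R[i] := (- (p - 2))%:C * c^*%C.
have sc : complex.Re (s * c) = - (p - 2) * normc c ^+ 2.
  by rewrite /s normc_sqr; case: (c) => a b /=; ring.
have isg := represents_integrable_normc (representsZ s vg).
have isgp := represents_integrable_powR (representsZ s vg).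
pose A := 4 * p ^+ 2 * (p - 2) ^+ 2 * normc c ^+ 2.
suff A0 : A <= 0.
  apply: eq0_normc; apply/eqP; rewrite -(sqrf_eq0 (normc _)); apply/eqP/le_anti.
  rewrite sqr_ge0 andbT -(pmulr_rle0 _ (_ : 0 < 4 * p ^+ 2 * (p - 2) ^+ 2))//.
  apply: mulr_gt0; last by rewrite exprn_even_gt0//= subr_eq0.
  by apply: mulr_gt0 => //; exact: exprn_gt0.
apply: (quadratic_le_cubic (K := C * (normc s * G))); first by rewrite !mulr_ge0// normc_ge0.
move=> d d01; rewrite -subr_ge0.
apply: (gauge_limit_ge0 (u := fun z => normc s * normc (g z)) (C := C)).
- by move=> z; rewrite mulr_ge0 ?normc_ge0.
- by apply: eq_integrable isg => // z _ /=; rewrite normcM.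
- by apply: eq_integrable isgp => // z _ /=; rewrite normcM.
move=> t t0; have := var d j (t%:C * s) d01.
have -> : normc (t%:C * s) = t * normc s by rewrite normcM normc_real gtr0_norm.
have -> : complex.Re (t%:C * s * fourier_coef g j) = t * (- (p - 2) * normc c ^+ 2).
  have ReC (b : R) (w : R[i]) : complex.Re (b%:C * w) = b * complex.Re w.
    by case: w => x y /=; rewrite mul0r subr0.
  by rewrite -mulrA ReC -/c sc.
rewrite -/G; under eq_Rintegral do rewrite -mulrA.
suff -> : 4 * p ^+ 2 * (p - 2) * d ^+ 2 * (t * (- (p - 2) * normc c ^+ 2)) +
    C * (d ^+ 3 * (t * normc s * G)) =
    t * (C * (normc s * G) * d ^+ 3 - A * d ^+ 2) by [].
by rewrite /A; ring.
Qed.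

End no_projection.

Theorem corollary1p5 (R : realType) (p : R) (p1 : 1 <= p) (p2 : p != 2) :
  ~ exists Y : set (Hp p1),
      [/\ Y <> [set: Hp p1], one_complemented Y & finite_codimension Y].
Proof.
move=> [Y [YT [[sY _] [P [[[_ PP] P1] PY]]] [n [e eY]]]].
have [x0 Px0] : exists x, P x != x.
  apply: contrapT => /forallNP h; apply: YT; apply/seteqP; split=> // x _.
  rewrite -PY; exists x => //.
  by have /negP := h x; rewrite negbK => /eqP.
pose v := x0 - P x0.
have Pv : P v = 0 by rewrite /v linearB/= PP subrr.
have v0 : v != 0 by rewrite subr_eq0 eq_sym.
have bj y s : Y y -> `|y| <= `|y + s *: v|.
  rewrite -PY => -[x _ <-]; have := contractive_le P1 (P x + s *: v).
  by rewrite linearD linearZ/= Pv scaler0 addr0 PP.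
have vg := represents_repr v.
have nearY : approaches (monomial p1) Y.
  apply: (spread_finite_codimension sY (spread_monomial p1)) => x.
  exact: eY.
have coef0 k : fourier_coef (Lp_repr (Hp_val v)) k = 0.
  case: k => k; first exact: fourier_coef_eq0 p2 vg sY nearY bj k.
  by have /asboolP h := Hp_prop v; exact: h.
have := fourier_uniqueness (represents_integrable vg) coef0 => vae.
have vL : Hp_val v = 0.
  rewrite -[LHS]Lp_reprK.
  by apply/(Lp_classP (Lp_repr (Hp_val v)) (0 : LpFun (circle_measure R) p1)).
by case/eqP: v0; apply: val_inj.
Qed.
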